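(* Let $X$ be a Banach space, $p\ge 1$, and let $B:X\to X$ be a linear operator that has a regular skeleton chain $\{B^i\}_{i=0}^p$ of length $p$ (as defined in the context), with associated operators $A_1,\dots,A_{2p}$ and spaces $X_0=X,X_1,\dots,X_p$. Put $M:=A_{2p}A_{2p-2}\cdots A_2: X\to X_p$. (a) Let $f:[0,\infty)\to X$ be $p$ times differentiable. Then for every $c_0\in X_p$ the initial value problem $$B\frac{dx}{dt}=x(t)+f(t),\quad 0\le t<\infty,\qquad Mx(t)\big|_{t=0}=c_0,$$ has a unique classical solution $x=x_0(t,c_0)$. (b) If the spectrum of the operator $B^p:X_p\to X_p$ lies in the left half-plane $\{\lambda\in\mathbb{C}:\operatorname{Re}\lambda<0\}$, then for every $c_0\in X_p$ the solution of the homogeneous problem $$B\frac{dx}{dt}=x,\quad 0\le t<\infty,\qquad Mx(t)\big|_{t=0}=c_0,$$ is asymptotically stable.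
   Context: Skeleton chain. Let $X$ be a Banach space, $B:X\to X$ a linear operator, and $p\ge1$ an integer. Let $X_0:=X$, let $X_1,\dots,X_p$ be normed linear spaces, and let $$A_{2i}:X_{i-1}\to X_i,\qquad A_{2i-1}:X_i\to X_{i-1},\qquad i=1,\dots,p,$$ be bounded linear operators. Put $B^0:=B$ and $B^i:=A_{2i}A_{2i-1}:X_i\to X_i$ for $i=1,\dots,p$. The superscript is an index of the chain, not a power of $B$. Suppose that: 1) $B=A_1A_2$, and $A_{2i}A_{2i-1}=A_{2i+1}A_{2i+2}$ for $i=1,\dots,p-1$; 2) the operators $B^0,B^1,\dots,B^{p-1}$ are not invertible (have no bounded everywhere-defined inverse), and $B^p:X_p\to X_p$ is either continuously invertible (bijective with bounded inverse) or the zero operator. Then $\{B^i\}_{i=0}^p$ is called an (attached) skeleton chain of $B$ of length $p$. It is called regular if $B^p$ is continuously invertible, and degenerate if $B^p$ is the zero operator. A classical solution is a differentiable function $x:[0,\infty)\to X$ (norm derivative, one-sided at $t=0$) that satisfies the equation for all $t\ge 0$ and satisfies the initial condition. The scalar field is $\mathbb{R}$ or $\mathbb{C}$; in the real case, spectrum means the spectrum of the complexification. Asymptotic stability is meant in the usual Lyapunov sense with respect to the initial data. Writing $x(t,c)$ for the solution with $Mx(0)=c$: for every $\varepsilon>0$ there is $\delta>0$ such that $\|c-c_0\|<\delta$ implies $\|x(t,c)-x(t,c_0)\|<\varepsilon$ for all $t\ge0$, and $\|x(t,c)-x(t,c_0)\|\to0$ as $t\to\infty$ for all $c$ sufficiently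 close to $c_0$. *)

(* Defs.v *)
(** Stdlib reals with Coquelicot's normed modules. *)
From Stdlib Require Import Reals Lra.
From Coquelicot Require Import Coquelicot.

Open Scope R_scope.

Inductive scalar_field : Set := Reals | Complexes.

Definition scalars (s : scalar_field) : AbsRing :=
  match s with Reals => R_AbsRing | Complexes => C_AbsRing end.

Definition of_real (s : scalar_field) : R -> scalars s :=
  match s return R -> scalars s with
  | Reals => fun r => r
  | Complexes => RtoC
  end.

(** [is_linear] is Coquelicot's notion of a bounded linear operator;
    [linear_map] does not require boundedness. *)
Definition linear_map {K : AbsRing} {U V : NormedModule K} (T : U -> V) : Prop :=
  (forall x y, T (plus x y) = plus (T x) (T y)) /\
  (forall (k : K) x, T (scal k x) = scal k (T x)).

Definition invertible {K : AbsRing} {V : NormedModule K} (T : V -> V) : Prop :=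
  exists S : V -> V,
    is_linear S /\ (forall x, S (T x) = x) /\ (forall x, T (S x) = x).

Lemma minus_plus_plus {G : AbelianGroup} (a b c d : G) :
  minus (plus a b) (plus c d) = plus (minus a c) (minus b d).
Proof.
  unfold minus. rewrite opp_plus, <- !plus_assoc. f_equal.
  rewrite !plus_assoc. f_equal. apply plus_comm.
Qed.

Lemma plus_plus_swap {G : AbelianGroup} (a b c d : G) :
  plus (plus a b) (plus c d) = plus (plus a c) (plus b d).
Proof.
  rewrite <- !plus_assoc. f_equal. rewrite !plus_assoc. f_equal. apply plus_comm.
Qed.

Lemma minus_minus_minus {G : AbelianGroup} (a b c d : G) :
  minus (minus a b) (plus c d) = minus (minus a d) (plus b c).
Proof.
  unfold minus. rewrite !opp_plus, <- !plus_assoc. f_equal.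
  rewrite !plus_assoc, (plus_comm _ (opp d)), !plus_assoc. reflexivity.
Qed.

Lemma plus_plus_minus {G : AbelianGroup} (a b c d : G) :
  plus (plus a b) (minus c d) = plus (minus a d) (plus b c).
Proof.
  unfold minus. rewrite <- !plus_assoc. f_equal.
  rewrite !plus_assoc, (plus_comm _ (opp d)), !plus_assoc. reflexivity.
Qed.

(** * Complexification of a real normed space

    The pair [(u, v)] stands for [u + i v]. *)

Section ComplexScaling.

Variable V : ModuleSpace R_Ring.

Definition cplx_scal (l : C) (w : V * V) : V * V :=
  (minus (scal (Re l) (fst w)) (scal (Im l) (snd w)),
   plus (scal (Re l) (snd w)) (scal (Im l) (fst w))).

Lemma cplx_scalE (a b : R) (u v : V) :
  cplx_scal (a, b) (u, v)
  = (minus (scal a u) (scal b v), plus (scal a v) (scal b u)).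
Proof. reflexivity. Qed.

Lemma scal_R0 (u : V) : scal 0 u = zero.
Proof. exact (scal_zero_l u). Qed.

Lemma minus_0_r (u : V) : minus u zero = u.
Proof. unfold minus. rewrite opp_zero. apply plus_zero_r. Qed.

Lemma scal_Rdistr (a : R) (u v : V) :
  scal a (plus u v) = plus (scal a u) (scal a v).
Proof. exact (scal_distr_l a u v). Qed.

Lemma scal_minus_distr (a : R) (u v : V) :
  scal a (minus u v) = minus (scal a u) (scal a v).
Proof. unfold minus. rewrite scal_Rdistr. f_equal. exact (scal_opp_r a v). Qed.

Lemma scal_Rplus (a b : R) (u : V) : scal (a + b) u = plus (scal a u) (scal b u).
Proof. exact (scal_distr_r a b u). Qed.

Lemma scal_Rminus (a b : R) (u : V) : scal (a - b) u = minus (scal a u) (scal b u).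
Proof.
  unfold Rminus, minus. rewrite scal_Rplus. f_equal. exact (scal_opp_l b u).
Qed.

Lemma scal_scal (a b : R) (u : V) : scal a (scal b u) = scal (a * b) u.
Proof. exact (scal_assoc a b u). Qed.

Lemma cplx_scal_assoc (x y : C) (w : V * V) :
  cplx_scal x (cplx_scal y w) = cplx_scal (x * y)%C w.
Proof.
  destruct x as [a b], y as [c d], w as [u v].
  change ((a, b) * (c, d))%C with (a * c - b * d, a * d + b * c).
  rewrite !cplx_scalE.
  rewrite !scal_Rminus, !scal_Rplus, !scal_minus_distr, !scal_Rdistr, !scal_scal.
  f_equal.
  - apply (@minus_minus_minus V).
  - apply (@plus_plus_minus V).
Qed.

Lemma cplx_scal_one (w : V * V) : cplx_scal 1%C w = w.
Proof.
  destruct w as [u v].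
  change ((minus (scal 1 u) (scal 0 v), plus (scal 1 v) (scal 0 u)) = (u, v)).
  rewrite !scal_R0, minus_0_r. f_equal.
  - exact (scal_one u).
  - eapply eq_trans; [apply (@plus_zero_r V) | exact (scal_one v)].
Qed.

Lemma cplx_scal_distr_l (x : C) (w z : V * V) :
  cplx_scal x (plus w z) = plus (cplx_scal x w) (cplx_scal x z).
Proof.
  destruct x as [a b], w as [u v], z as [u' v'].
  change (plus (u, v) (u', v')) with (plus u u', plus v v').
  rewrite !cplx_scalE, !scal_Rdistr.
  exact (f_equal2 pair (@minus_plus_plus V _ _ _ _) (@plus_plus_swap V _ _ _ _)).
Qed.

Lemma cplx_scal_distr_r (x y : C) (w : V * V) :
  cplx_scal (x + y)%C w = plus (cplx_scal x w) (cplx_scal y w).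
Proof.
  destruct x as [a b], y as [c d], w as [u v].
  change ((a, b) + (c, d))%C with (a + c, b + d).
  rewrite !cplx_scalE, !scal_Rplus.
  exact (f_equal2 pair (@minus_plus_plus V _ _ _ _) (@plus_plus_swap V _ _ _ _)).
Qed.

End ComplexScaling.

Arguments cplx_scal {V} l w.

Section Complexification.

Variable V : NormedModule R_AbsRing.

(** The norm is Taylor's norm, the supremum of [||Re (l (u + i v))||] over the
    complex numbers [l] of modulus at most 1.  All norms which make the
    complexification a complex normed space with the product topology are
    equivalent, so the spectrum below does not depend on this choice. *)
Definition cplx_norm_values (w : V * V) (r : R) : Prop :=
  exists l : C, Cmod l <= 1 /\ r = norm (fst (cplx_scal l w)).

Definition cplx_norm (w : V * V) : R := real (Lub_Rbar (cplx_norm_values w)).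

Lemma Re_le_Cmod (l : C) : Rabs (Re l) <= Cmod l.
Proof. eapply Rle_trans; [apply Rmax_l | exact (Rmax_Cmod l)]. Qed.

Lemma Im_le_Cmod (l : C) : Rabs (Im l) <= Cmod l.
Proof. eapply Rle_trans; [apply Rmax_r | exact (Rmax_Cmod l)]. Qed.

Lemma cplx_re_bound (l : C) (w : V * V) :
  norm (fst (cplx_scal l w)) <= Cmod l * (norm (fst w) + norm (snd w)).
Proof.
  change (norm (minus (scal (Re l) (fst w)) (scal (Im l) (snd w)))
          <= Cmod l * (norm (fst w) + norm (snd w))).
  unfold minus.
  eapply Rle_trans; [apply (@norm_triangle R_AbsRing V)|].
  rewrite (@norm_opp R_AbsRing V), Rmult_plus_distr_l.
  apply Rplus_le_compat.
  - eapply Rle_trans; [apply (norm_scal (Re l))|].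
    apply Rmult_le_compat_r; [apply norm_ge_0 | apply Re_le_Cmod].
  - eapply Rle_trans; [apply (norm_scal (Im l))|].
    apply Rmult_le_compat_r; [apply norm_ge_0 | apply Im_le_Cmod].
Qed.

Lemma cplx_norm_lub (w : V * V) :
  is_lub_Rbar (cplx_norm_values w) (Finite (cplx_norm w)).
Proof.
  unfold cplx_norm.
  assert (H := Lub_Rbar_correct (cplx_norm_values w)).
  destruct H as [Hub Hlub].
  assert (Hb : Rbar_le (Lub_Rbar (cplx_norm_values w))
                 (Finite (norm (fst w) + norm (snd w)))).
  { apply Hlub. intros r [l [Hl ->]]. simpl.
    eapply Rle_trans; [apply cplx_re_bound|].
    rewrite <- (Rmult_1_l (norm (fst w) + norm (snd w))) at 2.
    apply Rmult_le_compat_r; [|exact Hl].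
    generalize (norm_ge_0 (fst w)) (norm_ge_0 (snd w)); lra. }
  assert (H0 : Rbar_le (norm (fst (cplx_scal 0%C w))) (Lub_Rbar (cplx_norm_values w))).
  { apply Hub. exists 0%C. split; [rewrite Cmod_0; lra | reflexivity]. }
  destruct (Lub_Rbar (cplx_norm_values w)); simpl in *; try tauto.
  split; assumption.
Qed.

Lemma cplx_norm_ub (w : V * V) (l : C) :
  Cmod l <= 1 -> norm (fst (cplx_scal l w)) <= cplx_norm w.
Proof.
  intros Hl.
  exact (proj1 (cplx_norm_lub w) _ (ex_intro _ l (conj Hl eq_refl))).
Qed.

Lemma cplx_norm_least (w : V * V) (b : R) :
  (forall l, Cmod l <= 1 -> norm (fst (cplx_scal l w)) <= b) -> cplx_norm w <= b.
Proof.
  intros H. apply (proj2 (cplx_norm_lub w) (Finite b)).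
  intros r [l [Hl ->]]. exact (H l Hl).
Qed.

Definition cplx_ModuleSpace_mixin :
  ModuleSpace.mixin_of C_Ring (prod_AbelianGroup V V) :=
  ModuleSpace.Mixin C_Ring (prod_AbelianGroup V V) (@cplx_scal V)
    (cplx_scal_assoc V) (cplx_scal_one V) (cplx_scal_distr_l V) (cplx_scal_distr_r V).

Definition cplx_NormedModuleAux : NormedModuleAux C_AbsRing :=
  NormedModuleAux.Pack C_AbsRing (V * V)
    (NormedModuleAux.Class C_AbsRing (V * V)
       (ModuleSpace.Class C_Ring (V * V)
          (AbelianGroup.class (prod_AbelianGroup V V)) cplx_ModuleSpace_mixin)
       (UniformSpace.class (prod_UniformSpace V V)))
    (V * V).

Lemma cplx_norm_triangle (w z : cplx_NormedModuleAux) :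
  cplx_norm (plus w z) <= cplx_norm w + cplx_norm z.
Proof.
  apply cplx_norm_least. intros l Hl.
  assert (E := cplx_scal_distr_l V l w z).
  change (cplx_scal l (plus w z) = plus (cplx_scal l w) (cplx_scal l z)) in E.
  apply (f_equal fst) in E.
  change (fst (cplx_scal l (plus w z))
          = plus (fst (cplx_scal l w)) (fst (cplx_scal l z))) in E.
  rewrite E. eapply Rle_trans; [apply (@norm_triangle R_AbsRing V)|].
  apply Rplus_le_compat; apply cplx_norm_ub; exact Hl.
Qed.

Lemma cplx_norm_scal (l : C_AbsRing) (w : cplx_NormedModuleAux) :
  cplx_norm (scal l w) <= abs l * cplx_norm w.
Proof.
  change (cplx_norm (cplx_scal l w) <= Cmod l * cplx_norm w).
  apply cplx_norm_least. intros m Hm.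
  rewrite cplx_scal_assoc.
  destruct (Req_dec (Cmod l) 0) as [H0 | H0].
  - eapply Rle_trans; [apply cplx_re_bound|].
    rewrite Cmod_mult, H0. lra.
  - assert (Hp : 0 < Cmod l) by (generalize (Cmod_ge_0 l); lra).
    replace (m * l)%C with (RtoC (Cmod l) * (RtoC (/ Cmod l) * (m * l)))%C.
    2:{ rewrite Cmult_assoc, <- RtoC_mult, Rinv_r by exact H0. apply Cmult_1_l. }
    rewrite <- cplx_scal_assoc.
    set (z := cplx_scal _ w).
    assert (E : fst (cplx_scal (RtoC (Cmod l)) z) = scal (Cmod l) (fst z)).
    { change (minus (scal (Cmod l) (fst z)) (scal 0 (snd z)) = scal (Cmod l) (fst z)).
      rewrite (scal_R0 V). apply (minus_0_r V). }
    rewrite E. eapply Rle_trans; [apply (norm_scal (Cmod l))|].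
    change (abs (Cmod l)) with (Rabs (Cmod l)).
    rewrite (Rabs_pos_eq (Cmod l)) by lra.
    apply Rmult_le_compat_l; [lra|].
    apply cplx_norm_ub. rewrite !Cmod_mult, Cmod_R, Rabs_pos_eq.
    2:{ left. apply Rinv_0_lt_compat, Hp. }
    rewrite (Rmult_comm (Cmod m)), <- Rmult_assoc, Rinv_l, Rmult_1_l by exact H0.
    exact Hm.
Qed.

Lemma cplx_norm_fst (w : V * V) : norm (fst w) <= cplx_norm w.
Proof.
  rewrite <- (cplx_scal_one V w) at 1. apply cplx_norm_ub. rewrite Cmod_1; lra.
Qed.

Lemma cplx_norm_snd (w : V * V) : norm (snd w) <= cplx_norm w.
Proof.
  assert (E : fst (cplx_scal Ci w) = opp (snd w)).
  { change (minus (scal 0 (fst w)) (scal 1 (snd w)) = opp (snd w)).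
    rewrite (scal_R0 V), (scal_one (snd w) : scal 1 (snd w) = snd w).
    apply (@plus_zero_l V). }
  rewrite <- norm_opp, <- E. apply cplx_norm_ub.
  unfold Cmod; simpl. replace (0 * (0 * 1) + 1 * (1 * 1)) with 1 by ring.
  rewrite sqrt_1; lra.
Qed.

Lemma cplx_norm_le_sum (w : V * V) : cplx_norm w <= norm (fst w) + norm (snd w).
Proof.
  apply cplx_norm_least. intros l Hl.
  eapply Rle_trans; [apply cplx_re_bound|].
  rewrite <- (Rmult_1_l (norm (fst w) + norm (snd w))) at 2.
  apply Rmult_le_compat_r; [|exact Hl].
  generalize (norm_ge_0 (fst w)) (norm_ge_0 (snd w)); lra.
Qed.

Lemma cplx_norm_ball (x y : cplx_NormedModuleAux) (eps : R) :
  cplx_norm (minus y x) < eps -> ball x eps y.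
Proof.
  intros H. destruct x as [x1 x2], y as [y1 y2].
  change (cplx_norm (minus y1 x1, minus y2 x2) < eps) in H.
  split; apply norm_compat1; (eapply Rle_lt_trans; [|exact H]).
  - exact (cplx_norm_fst (minus y1 x1, minus y2 x2)).
  - exact (cplx_norm_snd (minus y1 x1, minus y2 x2)).
Qed.

Lemma cplx_ball_norm (x y : cplx_NormedModuleAux) (eps : posreal) :
  ball x eps y -> cplx_norm (minus y x) < 2 * @norm_factor _ V * eps.
Proof.
  intros [H1 H2]. destruct x as [x1 x2], y as [y1 y2].
  change (cplx_norm (minus y1 x1, minus y2 x2) < 2 * @norm_factor _ V * eps).
  eapply Rle_lt_trans; [apply cplx_norm_le_sum|]. simpl.
  apply (norm_compat2 (V := V)) in H1. apply (norm_compat2 (V := V)) in H2.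
  simpl in H1, H2. lra.
Qed.

Lemma cplx_norm_eq_zero (w : cplx_NormedModuleAux) : cplx_norm w = 0 -> w = zero.
Proof.
  intros H. destruct w as [u v].
  assert (H1 := cplx_norm_fst (u, v)). assert (H2 := cplx_norm_snd (u, v)).
  change (cplx_norm (u, v) = 0) in H. rewrite H in H1, H2. simpl in H1, H2.
  change ((u, v) = (zero, zero)). f_equal.
  - apply norm_eq_zero. apply Rle_antisym; [exact H1 | apply norm_ge_0].
  - apply norm_eq_zero. apply Rle_antisym; [exact H2 | apply norm_ge_0].
Qed.

Definition complexification : NormedModule C_AbsRing :=
  NormedModule.Pack C_AbsRing (V * V)
    (NormedModule.Class C_AbsRing (V * V)
       (NormedModuleAux.class C_AbsRing cplx_NormedModuleAux)
       (NormedModule.Mixin C_AbsRing cplx_NormedModuleAux cplx_norm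
          (2 * @norm_factor _ V) cplx_norm_triangle cplx_norm_scal
          cplx_norm_ball cplx_ball_norm cplx_norm_eq_zero))
    (V * V).

Definition complexify (T : V -> V) : complexification -> complexification :=
  fun w => (T (fst w), T (snd w)).

End Complexification.

(** * Spectrum *)

Definition complex_spectrum (V : NormedModule C_AbsRing) (T : V -> V) (l : C) : Prop :=
  ~ invertible (fun x => minus (T x) (scal l x)).

Definition spectrum {s : scalar_field} :
  forall V : NormedModule (scalars s), (V -> V) -> C -> Prop :=
  match s return forall V : NormedModule (scalars s), (V -> V) -> C -> Prop with
  | Reals => fun V T => complex_spectrum (complexification V) (complexify V T)
  | Complexes => fun V T => complex_spectrum V T
  end.

(** * Differentiability on the half-line

    Functions on [0, +oo) are represented by functions on [R], of which only the
    values at nonnegative times are used. *)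

Definition derivative_at {s : scalar_field} {V : NormedModule (scalars s)}
    (x : R -> V) (t : R) (l : V) : Prop :=
  filterlim (fun h => scal (of_real s (/ h)) (minus (x (t + h)) (x t)))
    (within (fun h => 0 <= t + h) (locally' 0)) (locally l).

Fixpoint times_differentiable {s : scalar_field} {V : NormedModule (scalars s)}
    (n : nat) (f : R -> V) : Prop :=
  match n with
  | O => True
  | S n => exists g : R -> V,
      (forall t, 0 <= t -> derivative_at f t (g t)) /\ times_differentiable n g
  end.

(** * Skeleton chains

    [chain_space X Y i] is the space [X_i]: [X_0 = X] and [X_(i+1) = Y i].  The
    operators are indexed by the lower of the two spaces which they connect:
    [Aup i : X_i -> X_(i+1)] is [A_(2i+2)] and [Adown i : X_(i+1) -> X_i] is
    [A_(2i+1)].  In a chain of length [p] only [X_0, ..., X_p] and the operators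
    with index [i < p] are relevant. *)
Section Chains.

Context {s : scalar_field}.
Variable X : CompleteNormedModule (scalars s).
Variable Y : nat -> NormedModule (scalars s).

Definition chain_space (i : nat) : NormedModule (scalars s) :=
  match i with
  | O => CompleteNormedModule.NormedModule (scalars s) X
  | S j => Y j
  end.

Variable B : chain_space 0 -> chain_space 0.
Variable Aup : forall i, chain_space i -> chain_space (S i).
Variable Adown : forall i, chain_space (S i) -> chain_space i.

Definition chain_op (i : nat) : chain_space i -> chain_space i :=
  match i return chain_space i -> chain_space i with
  | O => B
  | S j => fun x => Aup j (Adown j x)
  end.

(** [chain_factor] is [B = A_1 A_2] for [i = 0] and
    [A_(2i) A_(2i-1) = A_(2i+1) A_(2i+2)] for [0 < i < p]. *)
Record skeleton_chain (p : nat) : Prop := {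
  chain_Aup_bounded : forall i, (i < p)%nat -> is_linear (Aup i);
  chain_Adown_bounded : forall i, (i < p)%nat -> is_linear (Adown i);
  chain_factor : forall i, (i < p)%nat ->
    forall x, chain_op i x = Adown i (Aup i x);
  chain_not_invertible : forall i, (i < p)%nat -> ~ invertible (chain_op i);
  chain_end : invertible (chain_op p) \/ (forall x, chain_op p x = zero)
}.

Definition regular_skeleton_chain (p : nat) : Prop :=
  skeleton_chain p /\ invertible (chain_op p).

(** [chain_M p] is [A_(2p) A_(2p-2) ... A_2]. *)
Fixpoint chain_M (i : nat) : chain_space 0 -> chain_space i :=
  match i return chain_space 0 -> chain_space i with
  | O => fun x => x
  | S j => fun x => Aup j (chain_M j x)
  end.

End Chains.

Arguments chain_op {s X Y} B Aup Adown i _.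
Arguments skeleton_chain {s X Y} B Aup Adown p.
Arguments regular_skeleton_chain {s X Y} B Aup Adown p.
Arguments chain_M {s X Y} Aup i _.

(** * The initial value problem [B x' = x + f], [M x(0) = c] *)
Section Problem.

Context {s : scalar_field} {X Z : NormedModule (scalars s)}.
Variable B : X -> X.
Variable M : X -> Z.

Definition classical_solution (f : R -> X) (c : Z) (x : R -> X) : Prop :=
  (forall t, 0 <= t ->
     exists dx, derivative_at x t dx /\ B dx = plus (x t) (f t)) /\
  M (x 0) = c.

Definition homogeneous_solution (c : Z) (x : R -> X) : Prop :=
  (forall t, 0 <= t -> exists dx, derivative_at x t dx /\ B dx = x t) /\
  M (x 0) = c.

Definition asymptotically_stable (c0 : Z) (x0 : R -> X) : Prop :=
  (forall eps, 0 < eps -> exists delta, 0 < delta /\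
     forall c x, homogeneous_solution c x -> norm (minus c c0) < delta ->
       forall t, 0 <= t -> norm (minus (x t) (x0 t)) < eps) /\
  (exists rho, 0 < rho /\
     forall c x, homogeneous_solution c x -> norm (minus c c0) < rho ->
       is_lim (fun t => norm (minus (x t) (x0 t))) p_infty 0).

End Problem.

(* Main.v *)
Require Import Defs.
From Stdlib Require Import Reals Lra Lia List ClassicalEpsilon.
From Coquelicot Require Import Coquelicot.
Open Scope R_scope.

(** Write [T] for the last operator of the chain, [D] for its inverse, and put
    [N = A_1 A_3 ... A_(2p-1)].  The chain relations give [M B = T M], [B N = N T],
    [N M = B ^ p] and [M N = T ^ p], with genuine powers on the right.  Hence
    [lift = N D ^ p] is a right inverse of [M], and [proj = lift M] is a projection
    which commutes with [B].  On its range [B] is a copy of [T]; on its kernel, which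
    is the kernel of [M], [B] is nilpotent, because [B ^ p = N M].

    Uniqueness ([homogeneous_zero]).  The difference [w] of two solutions satisfies
    [B w' = w], so [u = M w] satisfies [u' = D u] with [u 0 = 0] and vanishes by
    Gronwall's inequality.  Then [B ^ p w = N M w = 0], and differentiating
    [B ^ (n + 1) w = 0] gives [B ^ n w = 0] until [w = 0] is reached.

    Existence ([solution_exists]).  On the nilpotent part the solution is
    [- sum_(k < p) B ^ k f^(k)], which is where [p] derivatives of [f] are spent
    ([solution_modulo_power]).  On the range of [proj] the equation becomes
    [z' = E (z + f)] with the bounded operator [E = lift D M], solved by Picard
    iteration in the Banach space [X] ([linear_ode_exists]).

    Stability.  A solution of the homogeneous equation is [lift (M w)]
    ([homogeneous_eq_lift]), so it suffices that the solutions of [u' = D u] decay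
    exponentially.  This is derived from the spectrum without contour integrals.
    Since [spec T] lies in the open left half-plane, [D - l] is bounded below
    uniformly for [Re l >= 0], by compactness ([shift_bounded_below_uniform]).  For
    small [h > 0] the Euler operator [W = 1 + h D] then has [1 - mu W] bounded below
    uniformly for [|mu| <= 1] ([euler_bounded_below]).  An elementary argument in the
    spirit of Rickart's proof of the spectral radius formula turns this into
    [||W ^ n|| <= 1 / 2] for some [n = 2 ^ m] ([dyadic_small_one]).  Consequently [W]
    contracts a functional equivalent to the norm ([contracts_square]), for which an
    Euler step of any length at most [h] is a strict contraction; this gives the
    exponential decay ([exponential_decay]). *)

(** * Identities between linear combinations of vectors *)

(** Two linear combinations of the same vectors are equal once their coefficients
    are.  Linear combinations are reified, so that the coefficients can be computed
    and compared by the tactics of the scalar field. *)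
Section LinearExpressions.

Context {K : Ring} {V : ModuleSpace K}.

Inductive lin_expr : Type :=
  | LAtom (n : nat)
  | LZero
  | LPlus (a b : lin_expr)
  | LOpp (a : lin_expr)
  | LMinus (a b : lin_expr)
  | LScal (k : K) (a : lin_expr).

Fixpoint lin_eval (env : list V) (e : lin_expr) : V :=
  match e with
  | LAtom n => nth n env zero
  | LZero => zero
  | LPlus a b => plus (lin_eval env a) (lin_eval env b)
  | LOpp a => opp (lin_eval env a)
  | LMinus a b => minus (lin_eval env a) (lin_eval env b)
  | LScal k a => scal k (lin_eval env a)
  end.

Fixpoint lin_coef (e : lin_expr) (i : nat) : K :=
  match e with
  | LAtom n => if Nat.eqb n i then one else zero
  | LZero => zero
  | LPlus a b => plus (lin_coef a i) (lin_coef b i)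
  | LOpp a => opp (lin_coef a i)
  | LMinus a b => minus (lin_coef a i) (lin_coef b i)
  | LScal k a => mult k (lin_coef a i)
  end.

Fixpoint lin_comb (c : nat -> K) (env : list V) : V :=
  match env with
  | nil => zero
  | cons x env => plus (scal (c O) x) (lin_comb (fun i => c (S i)) env)
  end.

Lemma lin_comb_ext (c d : nat -> K) (env : list V) :
  (forall i, c i = d i) -> lin_comb c env = lin_comb d env.
Proof.
  revert c d. induction env as [|x env IH]; intros c d H; simpl; [reflexivity|].
  rewrite H. f_equal. apply IH. intros i. apply H.
Qed.

Lemma lin_comb_zero (env : list V) : lin_comb (fun _ => zero) env = zero.
Proof.
  induction env as [|x env IH]; simpl; [reflexivity|].
  rewrite IH, plus_zero_r. apply scal_zero_l.
Qed.

Lemma lin_comb_plus (c d : nat -> K) (env : list V) :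
  lin_comb (fun i => plus (c i) (d i)) env = plus (lin_comb c env) (lin_comb d env).
Proof.
  revert c d. induction env as [|x env IH]; intros c d; simpl.
  - symmetry. apply plus_zero_l.
  - rewrite (IH (fun i => c (S i)) (fun i => d (S i))), scal_distr_r.
    apply (@plus_plus_swap V).
Qed.

Lemma lin_comb_scal (k : K) (c : nat -> K) (env : list V) :
  lin_comb (fun i => mult k (c i)) env = scal k (lin_comb c env).
Proof.
  revert c. induction env as [|x env IH]; intros c; simpl.
  - symmetry. apply scal_zero_r.
  - rewrite (IH (fun i => c (S i))), scal_distr_l, scal_assoc. reflexivity.
Qed.

Lemma lin_comb_opp (c : nat -> K) (env : list V) :
  lin_comb (fun i => opp (c i)) env = opp (lin_comb c env).
Proof.
  rewrite <- scal_opp_one, <- lin_comb_scal. apply lin_comb_ext. intros i.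
  rewrite <- opp_mult_l, mult_one_l. reflexivity.
Qed.

Lemma lin_comb_atom (n : nat) (env : list V) :
  lin_comb (fun i => if Nat.eqb n i then one else zero) env = nth n env zero.
Proof.
  revert n. induction env as [|x env IH]; intros [|n]; simpl; try reflexivity.
  - rewrite (scal_one x), lin_comb_zero. apply plus_zero_r.
  - rewrite IH, (scal_zero_l x). apply plus_zero_l.
Qed.

Lemma lin_evalE (env : list V) (e : lin_expr) :
  lin_eval env e = lin_comb (lin_coef e) env.
Proof.
  induction e; simpl.
  - symmetry. apply lin_comb_atom.
  - symmetry. apply lin_comb_zero.
  - rewrite IHe1, IHe2. symmetry. apply lin_comb_plus.
  - rewrite IHe. symmetry. apply lin_comb_opp.
  - rewrite IHe1, IHe2. unfold minus. rewrite lin_comb_plus, lin_comb_opp. reflexivity.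
  - rewrite IHe. symmetry. apply lin_comb_scal.
Qed.

Fixpoint coefs_agree (c d : nat -> K) (n : nat) : Prop :=
  match n with
  | O => True
  | S n => c O = d O /\ coefs_agree (fun i => c (S i)) (fun i => d (S i)) n
  end.

Lemma lin_eval_eq (env : list V) (e f : lin_expr) :
  coefs_agree (lin_coef e) (lin_coef f) (length env) -> lin_eval env e = lin_eval env f.
Proof.
  rewrite !lin_evalE. generalize (lin_coef e) (lin_coef f).
  induction env as [|x env IH]; intros c d; simpl; [reflexivity|].
  intros [H0 H]. rewrite H0, (IH _ _ H). reflexivity.
Qed.

End LinearExpressions.

Ltac lin_index x env :=
  lazymatch env with
  | cons x _ => constr:(O)
  | cons _ ?env => let n := lin_index x env in constr:(S n)
  end.

Ltac lin_atoms e env :=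
  lazymatch e with
  | zero => env
  | plus ?a ?b => let env := lin_atoms a env in lin_atoms b env
  | minus ?a ?b => let env := lin_atoms a env in lin_atoms b env
  | opp ?a => lin_atoms a env
  | scal _ ?a => lin_atoms a env
  | ?x => match env with
          | _ => let n := lin_index x env in env
          | _ => constr:(cons x env)
          end
  end.

Ltac lin_reify K e env :=
  lazymatch e with
  | zero => constr:(@LZero K)
  | plus ?a ?b =>
      let a := lin_reify K a env in let b := lin_reify K b env in constr:(@LPlus K a b)
  | minus ?a ?b =>
      let a := lin_reify K a env in let b := lin_reify K b env in constr:(@LMinus K a b)
  | opp ?a => let a := lin_reify K a env in constr:(@LOpp K a)
  | scal ?k ?a => let a := lin_reify K a env in constr:(@LScal K k a)
  | ?x => let n := lin_index x env in constr:(@LAtom K n)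
  end.

(** Reduces an equation between linear combinations of vectors of [V] to the
    equations between the coefficients of each atom. *)
Ltac lin_eq_in K V :=
  lazymatch goal with
  | |- ?x = ?y =>
      let env := lin_atoms x (@nil (ModuleSpace.sort K V)) in
      let env := lin_atoms y env in
      let e := lin_reify K x env in
      let f := lin_reify K y env in
      change (@lin_eval K V env e = @lin_eval K V env f);
      apply lin_eval_eq;
      cbn [lin_coef coefs_agree length Nat.eqb];
      repeat split
  end.

Ltac unfold_coefs :=
  unfold minus, plus, opp, mult, one, zero; simpl.

Ltac vec V :=
  lin_eq_in R_Ring (NormedModule.ModuleSpace R_AbsRing V); unfold_coefs;
  try (ring || (field; try lra)).

Ltac cvec_coefs V :=
  lin_eq_in C_Ring (NormedModule.ModuleSpace C_AbsRing V);
  match goal with |- ?a = ?b => change (@eq C a b) end; unfold_coefs.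

Ltac cvec V := cvec_coefs V; try ring.

(** * Norms and restriction of scalars *)

Section NormLemmas.

Context {K : AbsRing} {V : NormedModule K}.

Lemma norm_minus_sum (x y : V) : norm (minus x y) <= norm x + norm y.
Proof.
  unfold minus. eapply Rle_trans; [apply (@norm_triangle K V)|].
  rewrite (@norm_opp K V). lra.
Qed.

Lemma norm_le_plus_minus (x y : V) : norm x <= norm y + norm (minus x y).
Proof.
  replace x with (plus y (minus x y)) at 1.
  - apply (@norm_triangle K V).
  - unfold minus. rewrite (@plus_comm V), <- (@plus_assoc V), (@plus_opp_l V).
    apply (@plus_zero_r V).
Qed.

Lemma norm_minus_sym (x y : V) : norm (minus x y) = norm (minus y x).
Proof. rewrite <- (@norm_opp K V (minus y x)), (@opp_minus V). reflexivity. Qed.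

Lemma minus_eq_zero_eq (x y : V) : minus x y = zero -> x = y.
Proof.
  intros H. transitivity (plus (minus x y) y).
  - unfold minus. rewrite <- (@plus_assoc V), (@plus_opp_l V).
    symmetry. apply (@plus_zero_r V).
  - rewrite H. apply (@plus_zero_l V).
Qed.

End NormLemmas.

Lemma norm_scal_invertible {K : AbsRing} {V : NormedModule K} (a b : K) (x : V) :
  mult b a = one -> abs a * abs b = 1 -> norm (scal a x) = abs a * norm x.
Proof.
  intros Hba Hab. apply Rle_antisym; [apply norm_scal|].
  rewrite <- (scal_one x) at 1.
  replace (@one K) with (mult b a) by exact Hba. rewrite <- (scal_assoc b a x).
  eapply Rle_trans; [apply Rmult_le_compat_l; [apply abs_ge_0 | apply norm_scal]|].
  rewrite <- Rmult_assoc, Hab. lra.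
Qed.

Lemma norm_real_scal {V : NormedModule R_AbsRing} (a : R) (x : V) :
  norm (scal a x) = Rabs a * norm x.
Proof.
  destruct (Req_dec a 0) as [-> | Ha].
  - rewrite Rabs_R0, Rmult_0_l. transitivity (norm (@zero V)).
    + f_equal. vec V.
    + apply (@norm_zero _ V).
  - apply (norm_scal_invertible (K := R_AbsRing) a (/ a)).
    + apply Rinv_l, Ha.
    + change (Rabs a * Rabs (/ a) = 1).
      rewrite <- Rabs_mult, Rinv_r by exact Ha. apply Rabs_R1.
Qed.

Lemma norm_complex_scal {V : NormedModule C_AbsRing} (a : C) (x : V) :
  norm (scal a x) = Cmod a * norm x.
Proof.
  destruct (Ceq_dec a 0) as [-> | Ha].
  - rewrite Cmod_0, Rmult_0_l. transitivity (norm (@zero V)).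
    + f_equal. cvec V.
    + apply (@norm_zero _ V).
  - apply (norm_scal_invertible (K := C_AbsRing) a (/ a)%C).
    + apply Cinv_l, Ha.
    + change (Cmod a * Cmod (/ a) = 1).
      rewrite <- Cmod_mult, Cinv_r by exact Ha. apply Cmod_1.
Qed.

Lemma of_real_plus (s : scalar_field) (a b : R) :
  of_real s (a + b) = plus (of_real s a) (of_real s b).
Proof. destruct s; [reflexivity | apply RtoC_plus]. Qed.

Lemma of_real_mult (s : scalar_field) (a b : R) :
  of_real s (a * b) = mult (of_real s a) (of_real s b).
Proof. destruct s; [reflexivity | apply RtoC_mult]. Qed.

Lemma of_real_one (s : scalar_field) : of_real s 1 = one.
Proof. destruct s; reflexivity. Qed.

Lemma abs_of_real (s : scalar_field) (a : R) : abs (of_real s a) = Rabs a.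
Proof. destruct s; [reflexivity | apply Cmod_R]. Qed.

(** A normed space over either field, seen as a real normed space on the same
    carrier: derivatives along the half-line only involve real scalars, so that the
    analysis can be done once, over [R]. *)
Section Realification.

Context {s : scalar_field}.
Variable V : NormedModule (scalars s).

Definition realify_ModuleSpace_mixin :
  ModuleSpace.mixin_of R_Ring (NormedModule.AbelianGroup _ V).
Proof.
  refine (ModuleSpace.Mixin R_Ring (NormedModule.AbelianGroup _ V)
    (fun r (x : V) => scal (of_real s r) x) _ _ _ _).
  - intros a b x. change (scal (of_real s a) (scal (of_real s b) x)
      = scal (of_real s (a * b)) x).
    rewrite of_real_mult. apply (@scal_assoc _ V).
  - intros x. replace (of_real s one) with (@one (scalars s)).
    + apply (@scal_one _ V).
    + symmetry. apply of_real_one.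
  - intros a x y. apply (@scal_distr_l _ V).
  - intros a b x. change (scal (of_real s (a + b)) x
      = plus (scal (of_real s a) x) (scal (of_real s b) x)).
    rewrite of_real_plus. apply (@scal_distr_r _ V).
Defined.

Definition realify_NormedModuleAux : NormedModuleAux R_AbsRing :=
  NormedModuleAux.Pack R_AbsRing V
    (NormedModuleAux.Class R_AbsRing V
       (ModuleSpace.Class R_Ring V
          (AbelianGroup.class (NormedModule.AbelianGroup _ V))
          realify_ModuleSpace_mixin)
       (UniformSpace.class (NormedModule.UniformSpace _ V)))
    V.

Lemma realify_norm_scal (a : R) (x : V) :
  norm (scal (of_real s a) x) <= Rabs a * norm x.
Proof. rewrite <- (abs_of_real s). apply norm_scal. Qed.

Definition realify : NormedModule R_AbsRing :=
  NormedModule.Pack R_AbsRing V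
    (NormedModule.Class R_AbsRing V
       (NormedModuleAux.class R_AbsRing realify_NormedModuleAux)
       (NormedModule.Mixin R_AbsRing realify_NormedModuleAux
          (@norm _ V) (@norm_factor _ V)
          (@norm_triangle _ V) realify_norm_scal
          (@norm_compat1 _ V) (@norm_compat2 _ V) (@norm_eq_zero _ V)))
    V.

End Realification.

Definition realify_complete {s : scalar_field} (X : CompleteNormedModule (scalars s)) :
  CompleteNormedModule R_AbsRing :=
  CompleteNormedModule.Pack R_AbsRing X
    (CompleteNormedModule.Class R_AbsRing X
       (NormedModule.class R_AbsRing (realify X))
       (CompleteNormedModule.mixin _ X (CompleteNormedModule.class _ X)))
    X.

Lemma realify_is_linear {s : scalar_field} {U V : NormedModule (scalars s)} (T : U -> V) :
  is_linear T -> @is_linear R_AbsRing (realify U) (realify V) T.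
Proof.
  intros HT. constructor.
  - exact (linear_plus T HT).
  - intros r x. exact (linear_scal T HT (of_real s r) x).
  - exact (linear_norm T HT).
Qed.

(** * Derivatives on the half-line *)

Lemma locally_0_iff (P : R -> Prop) :
  locally 0 P <-> exists d, 0 < d /\ forall h, Rabs h < d -> P h.
Proof.
  split.
  - intros [d Hd]. exists d. split; [apply cond_pos|]. intros h Hh. apply Hd.
    change (Rabs (h - 0) < d). rewrite Rminus_0_r. exact Hh.
  - intros [d [Hp Hd]]. exists (mkposreal d Hp). intros h Hh. apply Hd.
    change (Rabs (h - 0) < d) in Hh. rewrite Rminus_0_r in Hh. exact Hh.
Qed.

Section HalfLineDerivative.

Context {V : NormedModule R_AbsRing}.

(** The derivative as a linear approximation: unlike the limit of the difference
    quotient, this form does not exclude [h = 0]. *)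
Definition half_deriv (x : R -> V) (t : R) (l : V) : Prop :=
  forall eps, 0 < eps -> exists delta, 0 < delta /\
    forall h, Rabs h < delta -> 0 <= t + h ->
      norm (minus (minus (x (t + h)) (x t)) (scal h l)) <= eps * Rabs h.

Lemma half_deriv_minus (x y : R -> V) t l m :
  half_deriv x t l -> half_deriv y t m ->
  half_deriv (fun t => minus (x t) (y t)) t (minus l m).
Proof.
  intros Hx Hy eps He.
  destruct (Hx (eps / 2)) as [d1 [P1 H1]]; [lra|].
  destruct (Hy (eps / 2)) as [d2 [P2 H2]]; [lra|].
  exists (Rmin d1 d2). split; [apply Rmin_pos; assumption|].
  intros h Hh Ht.
  assert (B1 := H1 h (Rlt_le_trans _ _ _ Hh (Rmin_l _ _)) Ht).
  assert (B2 := H2 h (Rlt_le_trans _ _ _ Hh (Rmin_r _ _)) Ht).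
  replace (minus (minus _ _) _) with
    (minus (minus (minus (x (t + h)) (x t)) (scal h l))
           (minus (minus (y (t + h)) (y t)) (scal h m))) by vec V.
  eapply Rle_trans; [apply (@norm_minus_sum _ V)|]. lra.
Qed.

Lemma half_deriv_const (c : V) t : half_deriv (fun _ => c) t zero.
Proof.
  intros eps He. exists 1. split; [lra|]. intros h _ _.
  replace (minus _ _) with (@zero V) by vec V. rewrite (@norm_zero _ V).
  apply Rmult_le_pos; [lra | apply Rabs_pos].
Qed.

Lemma half_deriv_ext (x y : R -> V) t l :
  (forall t, 0 <= t -> x t = y t) -> 0 <= t ->
  half_deriv x t l -> half_deriv y t l.
Proof.
  intros E Ht Hx eps He. destruct (Hx eps He) as [d [Pd Hd]].
  exists d. split; [exact Pd|]. intros h Hh Hth.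
  rewrite <- !E by assumption. apply Hd; assumption.
Qed.

Lemma half_deriv_plus (x y : R -> V) t l m :
  0 <= t -> half_deriv x t l -> half_deriv y t m ->
  half_deriv (fun t => plus (x t) (y t)) t (plus l m).
Proof.
  intros Ht Hx Hy.
  replace (plus l m) with (minus l (minus zero m)) by vec V.
  apply (half_deriv_ext (fun t => minus (x t) (minus zero (y t)))).
  - intros r _. vec V.
  - exact Ht.
  - apply half_deriv_minus; [exact Hx|].
    apply half_deriv_minus; [apply half_deriv_const | exact Hy].
Qed.

Lemma half_deriv_continuous (x : R -> V) t l :
  half_deriv x t l ->
  forall eps, 0 < eps -> exists delta, 0 < delta /\
    forall h, Rabs h < delta -> 0 <= t + h -> norm (minus (x (t + h)) (x t)) < eps.
Proof.
  intros Hx eps He.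
  destruct (Hx 1 Rlt_0_1) as [d [Pd Hd]].
  assert (Pl : 0 < norm l + 1) by (generalize (norm_ge_0 l); lra).
  exists (Rmin d (eps / (norm l + 1))).
  split; [apply Rmin_pos; [exact Pd | apply Rdiv_lt_0_compat; assumption]|].
  intros h Hh Ht.
  assert (B := Hd h (Rlt_le_trans _ _ _ Hh (Rmin_l _ _)) Ht).
  assert (Hh2 := Rlt_le_trans _ _ _ Hh (Rmin_r _ _)).
  apply (Rmult_lt_compat_r (norm l + 1)) in Hh2; [|exact Pl].
  unfold Rdiv in Hh2. rewrite Rmult_assoc, Rinv_l, Rmult_1_r in Hh2 by lra.
  assert (T := norm_le_plus_minus (minus (x (t + h)) (x t)) (scal h l)).
  rewrite norm_real_scal in T. lra.
Qed.

(** Every [t >= 0] can be approached from the right inside the half-line. *)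
Lemma half_deriv_unique (x : R -> V) t l m :
  0 <= t -> half_deriv x t l -> half_deriv x t m -> l = m.
Proof.
  intros Ht Hl Hm. apply minus_eq_zero_eq, norm_eq_zero.
  apply Rle_antisym; [|apply norm_ge_0].
  apply le_epsilon. intros eps He.
  destruct (Hl (eps / 2)) as [d1 [P1 H1]]; [lra|].
  destruct (Hm (eps / 2)) as [d2 [P2 H2]]; [lra|].
  set (h := Rmin d1 d2 / 2).
  assert (Pm : 0 < Rmin d1 d2) by (apply Rmin_pos; assumption).
  assert (Ph : 0 < h) by (unfold h; lra).
  assert (Eh : Rabs h = h) by (apply Rabs_pos_eq; lra).
  assert (L1 := Rmin_l d1 d2). assert (L2 := Rmin_r d1 d2).
  assert (B1 : norm (minus (minus (x (t + h)) (x t)) (scal h l)) <= eps / 2 * h).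
  { rewrite <- Eh at 3. apply H1; [rewrite Eh; unfold h; lra | lra]. }
  assert (B2 : norm (minus (minus (x (t + h)) (x t)) (scal h m)) <= eps / 2 * h).
  { rewrite <- Eh at 3. apply H2; [rewrite Eh; unfold h; lra | lra]. }
  apply (Rmult_le_reg_l h); [exact Ph|].
  rewrite <- Eh at 1. rewrite <- norm_real_scal.
  replace (scal h (minus l m)) with
    (minus (minus (minus (x (t + h)) (x t)) (scal h m))
           (minus (minus (x (t + h)) (x t)) (scal h l))) by vec V.
  eapply Rle_trans; [apply (@norm_minus_sum _ V)|]. lra.
Qed.

Lemma half_deriv_of_is_derive (x : R -> V) t l : is_derive x t l -> half_deriv x t l.
Proof.
  intros [_ H] eps He.
  specialize (H t (fun P H => H) (mkposreal eps He)).
  destruct H as [d Hd]. exists d. split; [apply cond_pos|].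
  intros h Hh _.
  assert (E : t + h - t = h) by ring.
  assert (B : ball t d (t + h)).
  { change (Rabs (t + h - t) < d). rewrite E. exact Hh. }
  specialize (Hd _ B).
  change (norm (minus (minus (x (t + h)) (x t)) (scal (t + h - t) l))
          <= eps * Rabs (t + h - t)) in Hd.
  rewrite E in Hd. exact Hd.
Qed.

End HalfLineDerivative.

Lemma half_deriv_linear {U V : NormedModule R_AbsRing} (T : U -> V) (x : R -> U) t l :
  is_linear T -> half_deriv x t l -> half_deriv (fun t => T (x t)) t (T l).
Proof.
  intros HT Hx eps He.
  destruct (linear_norm T HT) as [m [Pm Hm]].
  destruct (Hx (eps / m)) as [d [Pd Hd]]; [apply Rdiv_lt_0_compat; assumption|].
  exists d. split; [exact Pd|]. intros h Hh Ht.
  rewrite <- (linear_scal T HT), <- !(linear_minus T _ _ HT).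
  eapply Rle_trans; [apply Hm|].
  replace (eps * Rabs h) with (m * (eps / m * Rabs h)) by (field; lra).
  apply Rmult_le_compat_l; [lra | apply Hd; assumption].
Qed.

Lemma derivative_at_half {s : scalar_field} {V : NormedModule (scalars s)}
    (x : R -> V) (t : R) (l : V) :
  derivative_at x t l <-> @half_deriv (realify V) x t l.
Proof.
  unfold derivative_at. set (Vr := realify V).
  assert (E : forall h, h <> 0 ->
    norm (minus (@scal _ Vr (/ h) (minus (x (t + h)) (x t))) l) * Rabs h =
    @norm _ Vr (minus (minus (x (t + h)) (x t)) (@scal _ Vr h l))).
  { intros h Hh. rewrite Rmult_comm, <- (@norm_real_scal Vr). f_equal. vec Vr. }
  split.
  - intros H eps He.
    assert (H' := proj1 (@filterlim_locally_ball_norm _ _ V _ _ _ _) H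
      (mkposreal eps He)).
    apply (proj1 (locally_0_iff _)) in H'. destruct H' as [d [Pd Hd]].
    exists d. split; [exact Pd|]. intros h Hh Ht.
    destruct (Req_dec h 0) as [H0 | H0].
    + subst h. rewrite Rabs_R0, Rmult_0_r, Rplus_0_r. right.
      transitivity (norm (@zero Vr)); [|apply (@norm_zero _ Vr)].
      f_equal. vec Vr.
    + refine (Rle_trans _ _ _ (or_intror (eq_sym (E h H0))) _).
      apply Rmult_le_compat_r; [apply Rabs_pos|].
      left. exact (Hd h Hh H0 Ht).
  - intros H. apply (proj2 (@filterlim_locally_ball_norm _ _ V _ _ _ _)). intros eps.
    apply (proj2 (locally_0_iff _)).
    destruct (H (eps / 2)) as [d [Pd Hd]]; [generalize (cond_pos eps); lra|].
    exists d. split; [exact Pd|]. intros h Hh H0 Ht.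
    assert (B := Rle_trans _ _ _ (or_intror (E h H0)) (Hd h Hh Ht)).
    assert (Pa := Rabs_pos_lt h H0).
    apply Rmult_le_reg_r in B; [|exact Pa].
    eapply Rle_lt_trans; [exact B|]. generalize (cond_pos eps); lra.
Qed.

(** * Gronwall's inequality *)

Definition half_continuous (m : R -> R) : Prop :=
  forall t eps, 0 <= t -> 0 < eps -> exists delta, 0 < delta /\
    forall h, Rabs h < delta -> 0 <= t + h -> Rabs (m (t + h) - m t) < eps.

(** An upper bound [m' <= a m] on the upper right Dini derivative. *)
Definition right_growth (a : R) (m : R -> R) : Prop :=
  forall t eps, 0 <= t -> 0 < eps -> exists delta, 0 < delta /\
    forall k, 0 < k < delta -> m (t + k) <= m t + k * (a * m t + eps).

(** The last time [c] up to which [m] stays below the barrier exists by continuity,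
    and at [c] the barrier grows faster than [m]. *)
Lemma exp_barrier (m : R -> R) (a a' b : R) :
  half_continuous m -> right_growth a m -> a < a' -> m 0 < b -> 0 < b ->
  forall t, 0 <= t -> m t <= b * exp (a' * t).
Proof.
  intros Hc Hg Haa Hb Pb T HT.
  set (B := fun t => b * exp (a' * t)).
  assert (PB : forall t, 0 < B t).
  { intros t. apply Rmult_lt_0_compat; [exact Pb | apply exp_pos]. }
  set (S := fun t => 0 <= t <= T /\ forall r, 0 <= r <= t -> m r <= B r).
  assert (S0 : S 0).
  { split; [lra|]. intros r Hr. replace r with 0 by lra.
    unfold B. rewrite Rmult_0_r, exp_0. lra. }
  destruct (completeness S) as [c [Hub Hlub]].
  { exists T. intros t [Ht _]. lra. }
  { exists 0. exact S0. }
  assert (C0 : 0 <= c) by (apply Hub, S0).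
  assert (CT : c <= T) by (apply Hlub; intros t [Ht _]; lra).
  assert (Near : forall d, 0 < d -> exists r, c - d < r <= c /\ S r).
  { intros d Pd. apply NNPP. intros Hn.
    assert (c <= c - d); [|lra].
    apply Hlub. intros r Hr. apply Rnot_lt_le. intros Hrd.
    apply Hn. exists r. split; [|exact Hr]. split; [exact Hrd|].
    apply Hub, Hr. }
  assert (Bc : continuity_pt B c).
  { apply derivable_continuous_pt. unfold B. reg. }
  assert (Hmc : m c <= B c).
  { apply Rnot_lt_le. intros Hlt. set (g := m c - B c).
    assert (Pg : 0 < g / 2) by (unfold g; lra).
    destruct (Hc c (g / 2) C0 Pg) as [d1 [P1 H1]].
    destruct (proj1 (continuity_pt_locally B c) Bc (mkposreal _ Pg)) as [d2 H2].
    destruct (Near (Rmin d1 d2)) as [r [Hr [Hr0 Sr]]].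
    { apply Rmin_pos; [exact P1 | apply cond_pos]. }
    assert (L1 := Rmin_l d1 d2). assert (L2 := Rmin_r d1 d2).
    assert (E : c + (r - c) = r) by ring.
    specialize (H1 (r - c)). rewrite E in H1.
    specialize (H2 r). simpl in H2.
    assert (Ha : Rabs (r - c) < Rmin d1 d2) by (apply Rabs_def1; lra).
    assert (K1 := Rabs_def2 _ _ (H1 ltac:(lra) ltac:(lra))).
    assert (K2 := Rabs_def2 _ _ (H2 (Rlt_le_trans _ _ _ Ha L2))).
    specialize (Sr r ltac:(lra)). unfold g in *. lra. }
  assert (Sc : forall r, 0 <= r <= c -> m r <= B r).
  { intros r [Hr0 [Hr | ->]]; [|exact Hmc].
    destruct (Near (c - r)) as [r' [Hr' [_ Sr']]]; [lra|]. apply Sr'. lra. }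
  destruct CT as [CT | CT].
  2:{ rewrite <- CT. exact Hmc. }
  exfalso.
  (* The spare rate [a' - a] pays for the error term of the growth condition, and
     [1 + a k >= 0] keeps the one-step estimate monotone in [m c]. *)
  destruct (Hg c ((a' - a) * B c) C0) as [d [Pd Hd]].
  { apply Rmult_lt_0_compat; [lra | apply PB]. }
  set (d' := Rmin d (Rmin (T - c) (/ (1 + Rabs a)))).
  assert (Pa : 0 < 1 + Rabs a) by (generalize (Rabs_pos a); lra).
  assert (Pd' : 0 < d').
  { unfold d'. repeat apply Rmin_pos; try lra. apply Rinv_0_lt_compat, Pa. }
  assert (M1 : d' <= d) by apply Rmin_l.
  assert (M2 : d' <= T - c) by (eapply Rle_trans; [apply Rmin_r | apply Rmin_l]).
  assert (M3 : d' <= / (1 + Rabs a)) by (eapply Rle_trans; [apply Rmin_r | apply Rmin_r]).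
  assert (Sn : S (c + d' / 2)).
  { split; [lra|]. intros r Hr.
    destruct (Rle_lt_dec r c) as [Hrc | Hrc]; [apply Sc; lra|].
    set (k := r - c). assert (Hk : 0 < k < d') by (unfold k; lra).
    replace r with (c + k) by (unfold k; ring).
    eapply Rle_trans; [apply Hd; lra|].
    assert (K1 : 0 <= 1 + a * k).
    { assert (Hak : Rabs a * k <= 1).
      { apply Rle_trans with ((1 + Rabs a) * / (1 + Rabs a)).
        - apply Rmult_le_compat; try lra. apply Rabs_pos.
        - right. apply Rinv_r. lra. }
      assert (Hab := Rle_abs (- a)). rewrite Rabs_Ropp in Hab.
      assert (- a * k <= Rabs a * k) by (apply Rmult_le_compat_r; lra). lra. }
    assert (K2 : m c * (1 + a * k) <= B c * (1 + a * k)) by (apply Rmult_le_compat_r; lra).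
    assert (K3 : B c * (1 + a' * k) <= B (c + k)).
    { replace (B (c + k)) with (B c * exp (a' * k)).
      2:{ unfold B. rewrite Rmult_assoc, <- exp_plus, Rmult_plus_distr_l. reflexivity. }
      apply Rmult_le_compat_l; [left; apply PB | apply exp_ineq1_le]. }
    lra. }
  assert (Hbad := Hub _ Sn). lra.
Qed.

(** Letting the initial value of the barrier decrease to [m 0] removes the strict
    inequality at time 0; the loss in the rate remains. *)
Lemma right_growth_bound (m : R -> R) (a a' : R) :
  half_continuous m -> right_growth a m -> a < a' -> 0 <= m 0 ->
  forall t, 0 <= t -> m t <= m 0 * exp (a' * t).
Proof.
  intros Hc Hg Ha H0 t Ht. apply le_epsilon. intros eps He.
  assert (Pe := exp_pos (a' * t)).
  assert (Pq : 0 < eps / exp (a' * t)) by (apply Rdiv_lt_0_compat; assumption).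
  replace (m 0 * exp (a' * t) + eps) with ((m 0 + eps / exp (a' * t)) * exp (a' * t))
    by (field; lra).
  apply (exp_barrier m a a'); try assumption; lra.
Qed.

Section NormGrowth.

Context {V : NormedModule R_AbsRing}.

(** The growth of [q (u t)] can be read off a single Euler step, since [u (t + k)]
    and [u t + k u' t] differ by [o(k)].  A functional [q] replaces the norm because the
    decay below is visible only in a suitably chosen one. *)
Lemma seminorm_growth (q : V -> R) (c : R) (a a' k0 : R) (u du : R -> V) :
  0 < c -> 0 < k0 -> a < a' ->
  (forall x y, q (plus x y) <= q x + q y) ->
  (forall x, 0 <= q x <= c * norm x) ->
  (forall t, 0 <= t -> half_deriv u t (du t)) ->
  (forall t k, 0 <= t -> 0 < k < k0 ->
     q (plus (u t) (scal k (du t))) <= (1 + a * k) * q (u t)) ->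
  forall t, 0 <= t -> q (u t) <= q (u 0) * exp (a' * t).
Proof.
  intros Pc Pk Ha Hq Hqn Hu Hstep.
  apply (right_growth_bound (fun t => q (u t)) a a'); [| |exact Ha|apply Hqn].
  - intros t eps Ht He.
    destruct (half_deriv_continuous u t _ (Hu t Ht) (eps / c)) as [d [Pd Hd]].
    { apply Rdiv_lt_0_compat; assumption. }
    exists d. split; [exact Pd|]. intros h Hh Hth. specialize (Hd h Hh Hth).
    set (x := u (t + h)) in *. set (y := u t) in *.
    assert (A1 : q x <= q y + q (minus x y)).
    { replace x with (plus y (minus x y)) at 1 by vec V. apply Hq. }
    assert (A2 : q y <= q x + q (minus y x)).
    { replace y with (plus x (minus y x)) at 1 by vec V. apply Hq. }
    assert (N : norm (minus y x) = norm (minus x y)).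
    { replace (minus y x) with (opp (minus x y)) by vec V. apply (@norm_opp _ V). }
    assert (A3 := proj2 (Hqn (minus x y))). assert (A4 := proj2 (Hqn (minus y x))).
    rewrite N in A4.
    assert (A5 : c * norm (minus x y) < eps).
    { replace eps with (c * (eps / c)) by (field; lra).
      apply Rmult_lt_compat_l; assumption. }
    apply Rabs_def1; lra.
  - intros t eps Ht He.
    destruct (Hu t Ht (eps / c)) as [d [Pd Hd]].
    { apply Rdiv_lt_0_compat; assumption. }
    exists (Rmin d k0). split; [apply Rmin_pos; assumption|].
    intros k Hk. assert (L1 := Rmin_l d k0). assert (L2 := Rmin_r d k0).
    assert (Ek : Rabs k = k) by (apply Rabs_pos_eq; lra).
    specialize (Hd k ltac:(rewrite Ek; lra) ltac:(lra)).
    set (e := minus (minus (u (t + k)) (u t)) (scal k (du t))) in *.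
    replace (u (t + k)) with (plus (plus (u t) (scal k (du t))) e)
      by (unfold e; vec V).
    assert (A1 := Hq (plus (u t) (scal k (du t))) e).
    assert (A2 := Hstep t k Ht ltac:(lra)).
    assert (A3 := proj2 (Hqn e)).
    assert (A4 : c * norm e <= k * eps).
    { replace (k * eps) with (c * (eps / c * k)) by (field; lra).
      apply Rmult_le_compat_l; [lra|]. rewrite <- Ek at 1. exact Hd. }
    lra.
Qed.

Lemma linear_ode_zero (A : V -> V) (u : R -> V) :
  is_linear A -> (forall t, 0 <= t -> half_deriv u t (A (u t))) -> u 0 = zero ->
  forall t, 0 <= t -> u t = zero.
Proof.
  intros HA Hu H0 t Ht. destruct (linear_norm A HA) as [L [PL HL]].
  apply norm_eq_zero, Rle_antisym; [|apply norm_ge_0].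
  assert (G := seminorm_growth (@norm _ V) 1 L (L + 1) 1 u (fun t => A (u t))).
  replace 0 with (norm (u 0) * exp ((L + 1) * t)).
  - apply G; try lra; try assumption.
    + apply (@norm_triangle _ V).
    + intros x. generalize (norm_ge_0 x). lra.
    + intros r k Hr Hk. eapply Rle_trans; [apply (@norm_triangle _ V)|].
      rewrite norm_real_scal, Rabs_pos_eq by lra.
      assert (k * norm (A (u r)) <= k * (L * norm (u r)));
        [apply Rmult_le_compat_l; [lra | apply HL] | lra].
  - rewrite H0, (@norm_zero _ V). apply Rmult_0_l.
Qed.

End NormGrowth.

(** * Linear differential equations with a bounded operator *)

Lemma exp_le_exp (a b : R) : a <= b -> exp a <= exp b.
Proof. intros [H | ->]; [left; apply exp_increasing, H | right; reflexivity]. Qed.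

Lemma pow_half_small (c eps : R) : 0 < eps -> exists n, c * (1 / 2) ^ n < eps.
Proof.
  intros He. destruct (Rle_lt_dec c 0) as [Hc | Hc].
  - exists O. simpl. lra.
  - destruct (pow_lt_1_zero (1 / 2)) with (y := eps / c) as [n Hn].
    + rewrite Rabs_pos_eq; lra.
    + apply Rdiv_lt_0_compat; assumption.
    + exists n. specialize (Hn n (le_n n)).
      assert (P : 0 < (1 / 2) ^ n) by (apply pow_lt; lra).
      rewrite Rabs_pos_eq in Hn by lra.
      replace eps with (c * (eps / c)) by (field; lra).
      apply Rmult_lt_compat_l; assumption.
Qed.

Lemma Rmax_0_contraction (x y : R) : Rabs (Rmax 0 x - Rmax 0 y) <= Rabs (x - y).
Proof.
  assert (A := Rle_abs (x - y)). assert (B := Rle_abs (- (x - y))).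
  rewrite Rabs_Ropp in B.
  apply Rabs_le. unfold Rmax. destruct (Rle_dec 0 x), (Rle_dec 0 y); lra.
Qed.

Section Picard.

Context {X : CompleteNormedModule R_AbsRing}.
Variables (E : X -> X) (L : R).
Hypothesis E_linear : is_linear E.
Hypothesis L_pos : 0 < L.
Hypothesis E_bound : forall x, norm (E x) <= L * norm x.
Variable g : R -> X.
Hypothesis g_continuous : forall t, continuous g t.
Variable z0 : X.

Definition integrand (u : R -> X) (t : R) : X := plus (g t) (E (u t)).

Lemma continuous_integrand u : (forall t, continuous u t) ->
  forall t, continuous (integrand u) t.
Proof.
  intros Hu t. apply (@continuous_plus _ _ X); [apply g_continuous|].
  apply (continuous_comp u E); [apply Hu|]. exact (@linear_cont R_AbsRing X X E (u t) E_linear).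
Qed.

Lemma is_RInt_integrand u a b : (forall t, continuous u t) ->
  is_RInt (integrand u) a b (RInt (integrand u) a b).
Proof.
  intros Hu. apply (@RInt_correct X), (@ex_RInt_continuous X).
  intros t _. apply continuous_integrand, Hu.
Qed.

Definition picard (u : R -> X) (t : R) : X := plus z0 (RInt (integrand u) 0 t).

Lemma picard_derive u : (forall t, continuous u t) ->
  forall t, is_derive (picard u) t (integrand u t).
Proof.
  intros Hu t. unfold picard.
  rewrite <- (@plus_zero_l X (integrand u t)).
  apply (@is_derive_plus R_AbsRing X (fun _ => z0)); [apply (@is_derive_const _ X)|].
  apply (@is_derive_RInt X (integrand u)) with (a := 0).
  - exists (mkposreal 1 Rlt_0_1). intros y _. apply is_RInt_integrand, Hu.
  - apply continuous_integrand, Hu.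
Qed.

Lemma picard_continuous u : (forall t, continuous u t) ->
  forall t, continuous (picard u) t.
Proof.
  intros Hu t. apply (@ex_derive_continuous R_AbsRing X).
  eexists. apply picard_derive, Hu.
Qed.

Lemma picard_0 u : picard u 0 = z0.
Proof.
  unfold picard. rewrite (@RInt_point X). apply (@plus_zero_r X).
Qed.

(** Measured against the weight [exp (2 L t)], integrating the [L]-Lipschitz right
    hand side gains the factor [L / (2 L) = 1 / 2] on every bounded interval. *)
Lemma picard_contraction (u v : R -> X) T k :
  (forall t, continuous u t) -> (forall t, continuous v t) ->
  (forall t, 0 <= t <= T -> norm (minus (u t) (v t)) <= k * exp (2 * L * t)) ->
  forall t, 0 <= t <= T ->
    norm (minus (picard u t) (picard v t)) <= k / 2 * exp (2 * L * t).
Proof.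
  intros Hu Hv Huv t Ht. unfold picard.
  replace (minus _ _) with (minus (RInt (integrand u) 0 t) (RInt (integrand v) 0 t))
    by vec X.
  assert (Pk : 0 <= k).
  { specialize (Huv 0 ltac:(lra)). rewrite Rmult_0_r, exp_0 in Huv.
    generalize (norm_ge_0 (minus (u 0) (v 0))). lra. }
  apply Rle_trans with (k / 2 * exp (2 * L * t) - k / 2 * exp (2 * L * 0)).
  2:{ generalize (exp_pos (2 * L * 0)). intros P0.
      assert (0 <= k / 2 * exp (2 * L * 0)) by (apply Rmult_le_pos; lra). lra. }
  eapply (@norm_RInt_le X) with
    (f := fun r => minus (integrand u r) (integrand v r))
    (g := fun r => L * (k * exp (2 * L * r))) (a := 0) (b := t).
  - lra.
  - intros r Hr. unfold integrand.
    replace (minus (plus (g r) (E (u r))) (plus (g r) (E (v r))))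
      with (E (minus (u r) (v r))).
    + eapply Rle_trans; [apply E_bound|].
      apply Rmult_le_compat_l; [lra | apply Huv; lra].
    + rewrite (linear_minus E _ _ E_linear). vec X.
  - apply (@is_RInt_minus X); apply is_RInt_integrand; assumption.
  - apply (@is_RInt_derive R_CompleteNormedModule (fun r => k / 2 * exp (2 * L * r))).
    + intros r _. auto_derive; [exact I | field].
    + intros r _. apply (@ex_derive_continuous R_AbsRing R_NormedModule).
      auto_derive. exact I.
Qed.

Fixpoint picard_iter (n : nat) : R -> X :=
  match n with
  | O => fun _ => z0
  | S n => picard (picard_iter n)
  end.

Lemma picard_iter_continuous n t : continuous (picard_iter n) t.
Proof.
  revert t. induction n as [|n IH]; intros t.
  - apply continuous_const.
  - apply picard_continuous, IH.
Qed.

Lemma picard_iter_step T : exists c, forall n t, 0 <= t <= T ->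
  norm (minus (picard_iter (S n) t) (picard_iter n t)) <= c * (1 / 2) ^ n * exp (2 * L * t).
Proof.
  destruct (bounded_continuity (fun t => minus (picard_iter 1 t) (picard_iter 0 t)) 0 T)
    as [c Hc].
  { intros t _. apply (@continuous_minus _ _ X); apply picard_iter_continuous. }
  exists c. induction n as [|n IH]; intros t Ht.
  - rewrite pow_O, Rmult_1_r. specialize (Hc t Ht).
    assert (1 <= exp (2 * L * t)).
    { rewrite <- exp_0. apply exp_le_exp. apply Rmult_le_pos; lra. }
    assert (P := norm_ge_0 (minus (picard_iter 1 t) (picard_iter 0 t))).
    apply Rle_trans with (c * 1); [lra|]. apply Rmult_le_compat_l; lra.
  - replace (c * (1 / 2) ^ S n) with (c * (1 / 2) ^ n / 2) by (simpl; field).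
    apply (picard_contraction (picard_iter (S n)) (picard_iter n) T); try assumption;
      apply picard_iter_continuous.
Qed.

Lemma picard_iter_cauchy T : exists c, 0 < c /\ forall n j t, 0 <= t <= T ->
  norm (minus (picard_iter (j + n) t) (picard_iter n t)) <= c * (1 / 2) ^ n.
Proof.
  destruct (picard_iter_step T) as [c Hc].
  set (e := exp (2 * L * T)). assert (Pe : 0 < e) by apply exp_pos.
  set (c' := Rabs c * e). assert (Pc' : 0 <= c').
  { apply Rmult_le_pos; [apply Rabs_pos | lra]. }
  assert (Hs : forall n t, 0 <= t <= T ->
    norm (minus (picard_iter (S n) t) (picard_iter n t)) <= c' * (1 / 2) ^ n).
  { intros n t Ht. eapply Rle_trans; [apply Hc, Ht|].
    assert (P : 0 < (1 / 2) ^ n) by (apply pow_lt; lra).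
    replace (c' * (1 / 2) ^ n) with (Rabs c * (1 / 2) ^ n * e) by (unfold c'; ring).
    assert (exp (2 * L * t) <= e).
    { apply exp_le_exp. apply Rmult_le_compat_l; lra. }
    assert (Q := exp_pos (2 * L * t)).
    eapply Rle_trans.
    - apply Rmult_le_compat_r; [lra|]. apply Rmult_le_compat_r; [lra | apply Rle_abs].
    - apply Rmult_le_compat_l; [|assumption].
      apply Rmult_le_pos; [apply Rabs_pos | lra]. }
  exists (2 * c' + 1). split; [lra|]. intros n j t Ht.
  assert (P : forall i, 0 < (1 / 2) ^ i) by (intros i; apply pow_lt; lra).
  apply Rle_trans with (2 * c' * ((1 / 2) ^ n - (1 / 2) ^ (j + n))).
  - induction j as [|j IH].
    + simpl (0 + n)%nat. replace (minus _ _) with (@zero X) by vec X.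
      eapply Rle_trans; [right; apply (@norm_zero _ X) | lra].
    + assert (Hj := Hs (j + n)%nat t Ht).
      change (S j + n)%nat with (S (j + n)).
      replace (minus (picard_iter (S (j + n)) t) (picard_iter n t)) with
        (plus (minus (picard_iter (S (j + n)) t) (picard_iter (j + n) t))
              (minus (picard_iter (j + n) t) (picard_iter n t))) by vec X.
      eapply Rle_trans; [apply (@norm_triangle _ X)|].
      rewrite <- tech_pow_Rmult. lra.
  - assert (P1 := P n). assert (P2 := P (j + n)%nat).
    assert (0 <= c' * (1 / 2) ^ (j + n)) by (apply Rmult_le_pos; lra).
    lra.
Qed.

Lemma picard_limit t : 0 <= t ->
  exists l, filterlim (fun n => picard_iter n t) eventually (locally l).
Proof.
  intros Ht. apply (proj1 (@filterlim_locally_cauchy _ X eventually _ _)). intros eps.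
  destruct (picard_iter_cauchy t) as [c [Pc Hc]].
  destruct (pow_half_small (2 * c) eps (cond_pos eps)) as [n Hn].
  exists (fun m => (n <= m)%nat). split; [exists n; auto|]. intros u v Hu Hv.
  apply (@norm_compat1 _ X).
  replace u with ((u - n) + n)%nat by lia. replace v with ((v - n) + n)%nat by lia.
  assert (Bu := Hc n (u - n)%nat t ltac:(lra)). assert (Bv := Hc n (v - n)%nat t ltac:(lra)).
  replace (minus _ _) with
    (minus (minus (picard_iter (v - n + n) t) (picard_iter n t))
           (minus (picard_iter (u - n + n) t) (picard_iter n t))) by vec X.
  eapply Rle_lt_trans; [apply (@norm_minus_sum _ X)|]. lra.
Qed.

(** The estimate passes to the limit, so that the convergence is uniform on bounded
    intervals. *)
Lemma picard_limit_uniform (z : R -> X) T :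
  (forall t, 0 <= t -> filterlim (fun n => picard_iter n t) eventually (locally (z t))) ->
  exists c, 0 < c /\ forall n t, 0 <= t <= T ->
    norm (minus (z t) (picard_iter n t)) <= c * (1 / 2) ^ n.
Proof.
  intros Hz. destruct (picard_iter_cauchy T) as [c [Pc Hc]]. exists c. split; [exact Pc|].
  intros n t Ht. apply le_epsilon. intros eps He.
  assert (Hl := proj1 (@filterlim_locally_ball_norm _ _ X _ _ _ _)
    (Hz t (proj1 Ht)) (mkposreal eps He)).
  destruct Hl as [m Hm]. specialize (Hm (m + n)%nat ltac:(lia)).
  specialize (Hc n m t Ht). unfold ball_norm in Hm. simpl in Hm.
  replace (minus (z t) (picard_iter n t)) with
    (minus (minus (picard_iter (m + n) t) (picard_iter n t))
           (minus (picard_iter (m + n) t) (z t))) by vec X.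
  eapply Rle_trans; [apply (@norm_minus_sum _ X)|].
  exact (Rplus_le_compat _ _ _ _ Hc (Rlt_le _ _ Hm)).
Qed.

Lemma continuous_max_0 (u : R -> X) t :
  continuous u (Rmax 0 t) -> continuous (fun t => u (Rmax 0 t)) t.
Proof.
  intros Hu. apply (continuous_comp (fun t => Rmax 0 t) u); [|exact Hu].
  apply continuity_pt_filterlim, continuity_pt_locally. intros eps. exists eps.
  intros y Hy. exact (Rle_lt_trans _ _ _ (Rmax_0_contraction y t) Hy).
Qed.

(** The limit is controlled for [t >= 0] only.  Freezing it for negative times at its
    value at 0 makes it continuous on the whole line, so that its primitive has a
    two-sided derivative at 0 as well. *)
Lemma continuous_uniform_limit (z : R -> X) :
  (forall t, 0 <= t -> filterlim (fun n => picard_iter n t) eventually (locally (z t))) ->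
  forall t, continuous (fun t => z (Rmax 0 t)) t.
Proof.
  intros Hz t. apply (proj2 (@filterlim_locally_ball_norm _ _ X _ _ _ _)). intros eps.
  destruct (picard_limit_uniform z (Rmax 0 t + 1) Hz) as [c [Pc Hc]].
  destruct (pow_half_small c (eps / 3)) as [n Hn]; [generalize (cond_pos eps); lra|].
  assert (Hcont := continuous_max_0 (picard_iter n) t (picard_iter_continuous n _)).
  assert (P3 : 0 < eps / 3) by (generalize (cond_pos eps); lra).
  assert (Hb := proj1 (@filterlim_locally_ball_norm _ _ X _ _ _ _) Hcont (mkposreal _ P3)).
  assert (Hn1 : locally t (fun y => Rabs (y - t) < 1)).
  { exists (mkposreal 1 Rlt_0_1). intros y Hy. exact Hy. }
  generalize (filter_and _ _ Hb Hn1). apply filter_imp. intros y [Hy Hyt].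
  unfold ball_norm in *. simpl in Hy. apply Rabs_def2 in Hyt.
  assert (M0 : 0 <= Rmax 0 t) by apply Rmax_l.
  assert (My : 0 <= Rmax 0 y <= Rmax 0 t + 1).
  { unfold Rmax; destruct (Rle_dec 0 y), (Rle_dec 0 t); lra. }
  assert (B1 := Hc n _ My). assert (B2 := Hc n (Rmax 0 t) ltac:(lra)).
  set (a := z (Rmax 0 y)) in *. set (b := z (Rmax 0 t)) in *.
  set (a' := picard_iter n (Rmax 0 y)) in *. set (b' := picard_iter n (Rmax 0 t)) in *.
  change (norm (minus a b) < eps).
  replace (minus a b) with (minus (plus (minus a' b') (minus a a')) (minus b b')) by vec X.
  change (norm (minus a' b') < eps / 3) in Hy.
  eapply Rle_lt_trans; [apply (@norm_minus_sum _ X)|].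
  eapply Rle_lt_trans; [apply Rplus_le_compat_r, (@norm_triangle _ X)|]. lra.
Qed.

(** Both [picard z] and [z] are uniform limits of the iterates. *)
Lemma picard_fixed_point (z : R -> X) :
  (forall t, 0 <= t -> filterlim (fun n => picard_iter n t) eventually (locally (z t))) ->
  forall t, 0 <= t -> picard (fun t => z (Rmax 0 t)) t = z t.
Proof.
  intros Hz t Ht. apply minus_eq_zero_eq, norm_eq_zero.
  apply Rle_antisym; [|apply norm_ge_0]. apply le_epsilon. intros eps He.
  destruct (picard_limit_uniform z t Hz) as [c [Pc Hc]].
  set (e := exp (2 * L * t)).
  destruct (pow_half_small (c * e + c) eps He) as [n Hn].
  assert (P : 0 < (1 / 2) ^ n) by (apply pow_lt; lra).
  assert (Pe : 0 < e) by apply exp_pos.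
  assert (B0 : forall r, 0 <= r <= t ->
    norm (minus (z (Rmax 0 r)) (picard_iter n r)) <= c * (1 / 2) ^ n * exp (2 * L * r)).
  { intros r Hr. rewrite Rmax_right by lra. eapply Rle_trans; [apply Hc, Hr|].
    rewrite <- (Rmult_1_r (c * (1 / 2) ^ n)) at 1.
    apply Rmult_le_compat_l; [apply Rmult_le_pos; lra|].
    rewrite <- exp_0. apply exp_le_exp. apply Rmult_le_pos; lra. }
  assert (B1 := picard_contraction (fun t => z (Rmax 0 t)) (picard_iter n) t
    (c * (1 / 2) ^ n) (continuous_uniform_limit z Hz) (picard_iter_continuous n)
    B0 t ltac:(lra)).
  assert (B2 := Hc (S n) t ltac:(lra)).
  fold e in B1. rewrite <- tech_pow_Rmult in B2.
  change (picard (picard_iter n) t) with (picard_iter (S n) t) in B1.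
  set (y := picard _ t) in *. set (w := picard_iter (S n) t) in *.
  change (norm (minus y w) <= c * (1 / 2) ^ n / 2 * e) in B1.
  change (norm (minus (z t) w) <= c * (1 / 2 * (1 / 2) ^ n)) in B2.
  change (norm (minus y (z t)) <= 0 + eps).
  replace (minus y (z t)) with (minus (minus y w) (minus (z t) w)) by vec X.
  eapply Rle_trans; [apply (@norm_minus_sum _ X)|].
  assert (0 <= c * (1 / 2) ^ n * e) by (repeat apply Rmult_le_pos; lra).
  assert (0 <= c * (1 / 2) ^ n) by (apply Rmult_le_pos; lra). lra.
Qed.

End Picard.

Definition linear_ode_solvable (X : NormedModule R_AbsRing) : Prop :=
  forall (E : X -> X) (g dg : R -> X) (z0 : X),
    is_linear E -> (forall t, 0 <= t -> half_deriv g t (dg t)) ->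
    exists z : R -> X, z 0 = z0 /\
      forall t, 0 <= t -> half_deriv z t (plus (g t) (E (z t))).

Lemma linear_ode_exists (X : CompleteNormedModule R_AbsRing) : linear_ode_solvable X.
Proof.
  intros E g dg z0 HE Hg. destruct (linear_norm E HE) as [L [PL HL]].
  (* [g] is also frozen for negative times, where nothing is known about it. *)
  set (g' := fun t => g (Rmax 0 t)).
  assert (Cg : forall t, continuous g' t).
  { intros t. apply (proj2 (@filterlim_locally_ball_norm _ _ X _ _ _ _)). intros eps.
    destruct (half_deriv_continuous g (Rmax 0 t) _ (Hg _ (Rmax_l _ _)) eps (cond_pos eps))
      as [d [Pd Hd]].
    exists (mkposreal d Pd). intros y Hy. change (Rabs (y - t) < d) in Hy.
    unfold ball_norm, g'. specialize (Hd (Rmax 0 y - Rmax 0 t)).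
    replace (Rmax 0 t + (Rmax 0 y - Rmax 0 t)) with (Rmax 0 y) in Hd by ring.
    apply Hd; [|apply Rmax_l]. exact (Rle_lt_trans _ _ _ (Rmax_0_contraction y t) Hy). }
  assert (Hlim : forall t, exists l, 0 <= t ->
    filterlim (fun n => picard_iter E g' z0 n t) eventually (locally l)).
  { intros t. destruct (Rle_lt_dec 0 t) as [Ht | Ht].
    - destruct (picard_limit E L HE PL HL g' Cg z0 t Ht) as [l Hl]. exists l. auto.
    - exists z0. intros H. lra. }
  set (z := fun t => proj1_sig (constructive_indefinite_description _ (Hlim t))).
  assert (Hz : forall t, 0 <= t ->
    filterlim (fun n => picard_iter E g' z0 n t) eventually (locally (z t))).
  { intros t. exact (proj2_sig (constructive_indefinite_description _ (Hlim t))). }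
  set (y := picard E g' z0 (fun t => z (Rmax 0 t))).
  assert (Hy : forall t, 0 <= t -> y t = z t).
  { apply (picard_fixed_point E L HE PL HL g' Cg z0 z Hz). }
  exists y. split; [apply picard_0|]. intros t Ht.
  apply half_deriv_of_is_derive.
  assert (D := picard_derive E HE g' Cg z0 (fun t => z (Rmax 0 t))
    (continuous_uniform_limit E L HE PL HL g' Cg z0 z Hz) t).
  replace (plus (g t) (E (y t))) with (integrand E g' (fun t => z (Rmax 0 t)) t).
  - exact D.
  - unfold integrand, g'. rewrite Rmax_right, Hy by exact Ht. reflexivity.
Qed.

(** * From resolvent bounds on the unit disc to small powers *)

Lemma complex_sqrt (w : C) : exists z : C, (z * z)%C = w.
Proof.
  assert (P := Cmod2_alt w). destruct w as [a b]. simpl in P.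
  set (m := Cmod (a, b)) in *. assert (Pm : 0 <= m) by apply Cmod_ge_0.
  assert (Ha : 0 <= (m + a) / 2 /\ 0 <= (m - a) / 2) by (split; nra).
  destruct Ha as [H1 H2].
  set (u := sqrt ((m + a) / 2)). set (v := sqrt ((m - a) / 2)).
  assert (Eu : u * u = (m + a) / 2) by (apply sqrt_sqrt; exact H1).
  assert (Ev : v * v = (m - a) / 2) by (apply sqrt_sqrt; exact H2).
  assert (Pu : 0 <= u) by apply sqrt_pos. assert (Pv : 0 <= v) by apply sqrt_pos.
  assert (Euv : (2 * (u * v)) * (2 * (u * v)) = b * b).
  { replace ((2 * (u * v)) * (2 * (u * v))) with (4 * (u * u) * (v * v)) by ring.
    rewrite Eu, Ev. nra. }
  assert (Puv : 0 <= u * v) by (apply Rmult_le_pos; assumption).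
  destruct (Rle_lt_dec 0 b) as [Hb | Hb].
  - exists (u, v). unfold Cmult. simpl. f_equal; nra.
  - exists (u, - v). unfold Cmult. simpl. f_equal; nra.
Qed.

Section Doubling.

Context {V : NormedModule C_AbsRing}.
Variables (W : V -> V) (w K : R).
Hypothesis W_linear : is_linear W.
Hypothesis w_pos : 0 < w.
Hypothesis W_bound : forall x, norm (W x) <= w * norm x.
Hypothesis K_pos : 0 < K.
Hypothesis bounded_below : forall (m : C) (x : V), Cmod m <= 1 ->
  norm x <= K * norm (minus x (scal m (W x))).

(** The power [(r W) ^ (2 ^ m)]. *)
Fixpoint dyadic_power (r : R) (m : nat) (x : V) : V :=
  match m with
  | O => scal (RtoC r) (W x)
  | S m => dyadic_power r m (dyadic_power r m x)
  end.

Lemma dyadic_power_plus r m (x y : V) :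
  dyadic_power r m (plus x y) = plus (dyadic_power r m x) (dyadic_power r m y).
Proof.
  revert x y. induction m as [|m IH]; intros x y; simpl.
  - rewrite (linear_plus W W_linear). cvec V.
  - rewrite !IH. reflexivity.
Qed.

Lemma dyadic_power_scal r m (k : C) (x : V) :
  dyadic_power r m (scal k x) = scal k (dyadic_power r m x).
Proof.
  revert x. induction m as [|m IH]; intros x; simpl.
  - rewrite (linear_scal W W_linear). cvec V.
  - rewrite !IH. reflexivity.
Qed.

(** The solutions of [(1 - mu (r W) ^ n) x = a] and [(1 - mu (s W) ^ n) y = b] are
    close when [r] is close to [s] and [a] to [b], with constants that do not depend
    on [n = 2 ^ m].  The identity
    [1 / (1 - mu A ^ 2) = (1 / (1 - nu A) + 1 / (1 + nu A)) / 2] with [nu ^ 2 = mu]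
    exhibits the inverse for [2 n] as the mean of two inverses for [n], so that the
    estimate for [n] is inherited by [2 n].  Allowing [a] and [b] to differ avoids
    solving any equation. *)
Lemma dyadic_power_close (r s : R) : 0 <= r <= 1 -> 0 <= s <= 1 ->
  forall m (mu : C) (x y : V), Cmod mu <= 1 ->
  norm (minus x y) <=
    K * K * w * Rabs (r - s) * norm (minus y (scal mu (dyadic_power s m y))) +
    K * norm (minus (minus x (scal mu (dyadic_power r m x)))
                    (minus y (scal mu (dyadic_power s m y)))).
Proof.
  intros Hr Hs m. induction m as [|m IH]; intros mu x y Hmu; simpl.
  - set (Y := minus y (scal mu (scal (RtoC s) (W y)))).
    set (A := minus (minus x (scal mu (scal (RtoC r) (W x)))) Y).
    assert (Bound : forall q, 0 <= q <= 1 -> Cmod (mu * RtoC q) <= 1).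
    { intros q Hq. rewrite Cmod_mult, Cmod_R, Rabs_pos_eq by lra.
      rewrite <- (Rmult_1_r 1). apply Rmult_le_compat; try lra. apply Cmod_ge_0. }
    assert (By : norm y <= K * norm Y).
    { replace Y with (minus y (scal (mu * RtoC s)%C (W y))) by (unfold Y; cvec V).
      apply bounded_below, Bound, Hs. }
    assert (Bx := bounded_below (mu * RtoC r) (minus x y) (Bound r Hr)).
    replace (W (minus x y)) with (minus (W x) (W y)) in Bx.
    2:{ transitivity (W (plus x (scal (RtoC (-1)) y))).
        - rewrite (linear_plus W W_linear), (linear_scal W W_linear). cvec V.
        - f_equal. cvec V. }
    replace (minus (minus x y) (scal (mu * RtoC r)%C (minus (W x) (W y)))) with
      (plus A (scal (mu * (RtoC r - RtoC s))%C (W y))) in Bx by (unfold A, Y; cvec V).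
    eapply Rle_trans; [exact Bx|].
    assert (T : norm (plus A (scal (mu * (RtoC r - RtoC s))%C (W y)))
                <= norm A + Rabs (r - s) * (w * (K * norm Y))).
    { eapply Rle_trans; [apply (@norm_triangle _ V)|]. apply Rplus_le_compat_l.
      rewrite norm_complex_scal, Cmod_mult, <- RtoC_minus, Cmod_R.
      assert (P1 := Rabs_pos (r - s)). assert (P2 := Cmod_ge_0 mu).
      assert (P3 := norm_ge_0 (W y)).
      rewrite Rmult_assoc. rewrite <- (Rmult_1_l (Rabs (r - s) * (w * (K * norm Y)))).
      apply Rmult_le_compat; try lra.
      - apply Rmult_le_pos; assumption.
      - apply Rmult_le_compat_l; [exact P1|].
        eapply Rle_trans; [apply W_bound|]. apply Rmult_le_compat_l; lra. }
    apply (Rmult_le_compat_l K) in T; [|lra]. eapply Rle_trans; [exact T|].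
    right. ring.
  - destruct (complex_sqrt mu) as [nu Hnu].
    assert (Bnu : Cmod nu <= 1).
    { rewrite <- Hnu, Cmod_mult in Hmu. assert (P := Cmod_ge_0 nu). nra. }
    assert (Bnu' : Cmod (- nu) <= 1) by (rewrite Cmod_opp; exact Bnu).
    (* [1 - mu A ^ 2 = (1 - nu A) (1 + nu A)], so [(1 + nu A) x] solves the equation
       for [nu] with the right-hand side [(1 - mu A ^ 2) x]; the same holds with
       [- nu], and [x] is the mean of the two solutions. *)
    assert (F : forall (q : R) (nu : C) (z : V), (nu * nu)%C = mu ->
      minus (plus z (scal nu (dyadic_power q m z)))
        (scal nu (dyadic_power q m (plus z (scal nu (dyadic_power q m z))))) =
      minus z (scal mu (dyadic_power q m (dyadic_power q m z)))).
    { intros q n z <-. rewrite dyadic_power_plus, dyadic_power_scal. cvec V. }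
    assert (Hnu' : (- nu * - nu)%C = mu) by (rewrite <- Hnu; ring).
    assert (B1 := IH nu (plus x (scal nu (dyadic_power r m x)))
                        (plus y (scal nu (dyadic_power s m y))) Bnu).
    assert (B2 := IH (- nu)%C (plus x (scal (- nu)%C (dyadic_power r m x)))
                              (plus y (scal (- nu)%C (dyadic_power s m y))) Bnu').
    rewrite (F r nu x Hnu), (F s nu y Hnu) in B1.
    rewrite (F r _ x Hnu'), (F s _ y Hnu') in B2.
    apply (Rmult_le_reg_l 2); [lra|].
    replace (2 * norm (minus x y)) with (norm (scal (RtoC 2) (minus x y))).
    2:{ rewrite norm_complex_scal, Cmod_R, Rabs_pos_eq by lra. reflexivity. }
    replace (scal (RtoC 2) (minus x y)) with
      (plus (minus (plus x (scal nu (dyadic_power r m x)))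
                   (plus y (scal nu (dyadic_power s m y))))
            (minus (plus x (scal (- nu)%C (dyadic_power r m x)))
                   (plus y (scal (- nu)%C (dyadic_power s m y))))) by cvec V.
    eapply Rle_trans; [apply (@norm_triangle _ V)|].
    rewrite <- Rplus_diag. apply Rplus_le_compat; assumption.
Qed.

Definition dyadic_small (r eps : R) : Prop :=
  exists m, forall x, norm (dyadic_power r m x) <= eps * norm x.

Lemma dyadic_small_improve r eps :
  dyadic_small r (1 / 2) -> 0 < eps -> dyadic_small r eps.
Proof.
  intros [m Hm] He.
  assert (H : forall j x, norm (dyadic_power r (j + m) x) <= (1 / 2) ^ S j * norm x).
  { induction j as [|j IH]; intros x.
    - simpl (0 + m)%nat. rewrite pow_1. apply Hm.
    - change (S j + m)%nat with (S (j + m)). simpl dyadic_power.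
      eapply Rle_trans; [apply IH|].
      assert (Hj : (1 / 2) ^ S j <= 1 / 2).
      { assert (P : 0 < (1 / 2) ^ j <= 1).
        { split; [apply pow_lt; lra|].
          apply Rle_trans with (1 ^ j); [apply pow_incr; lra | rewrite pow1; lra]. }
        simpl. lra. }
      assert (P : 0 < (1 / 2) ^ S j) by (apply pow_lt; lra).
      rewrite <- (tech_pow_Rmult (1 / 2) (S j)), Rmult_assoc.
      apply Rmult_le_compat; try lra.
      + apply norm_ge_0.
      + apply IH. }
  destruct (pow_half_small 1 eps He) as [j Hj]. exists (j + m)%nat. intros x.
  eapply Rle_trans; [apply H|]. apply Rmult_le_compat_r; [apply norm_ge_0|].
  assert (P : 0 < (1 / 2) ^ j) by (apply pow_lt; lra). simpl. lra.
Qed.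

(** If [(r W) ^ n] is small, then [1 - (r W) ^ n] is close to 1, hence so is the inverse
    of [1 - (s W) ^ n], and [(s W) ^ n] is small as well. *)
Lemma dyadic_small_step r s :
  0 <= r <= 1 -> 0 <= s <= 1 -> K * K * w * Rabs (r - s) <= 1 / 8 ->
  dyadic_small r (1 / 2) -> dyadic_small s (1 / 2).
Proof.
  intros Hr Hs Hrs Hsmall.
  (* [eps = 1 / (8 K)] and the bound on [r - s] contribute [1 / 8] each, so that
     [||(s W) ^ n y|| <= ||y - (s W) ^ n y|| / 4 <= (||y|| + ||(s W) ^ n y||) / 4]. *)
  destruct (dyadic_small_improve r (/ (8 * K)) Hsmall) as [m Hm].
  { apply Rinv_0_lt_compat. lra. }
  exists m. intros y. set (Y := minus y (dyadic_power s m y)).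
  assert (B := dyadic_power_close r s Hr Hs m 1%C Y y).
  replace (minus y (scal (RtoC 1) (dyadic_power s m y))) with Y in B
    by (unfold Y; cvec V).
  replace (minus (minus Y (scal (RtoC 1) (dyadic_power r m Y))) Y) with
    (opp (dyadic_power r m Y)) in B by cvec V.
  rewrite Cmod_1, (@norm_opp _ V) in B. specialize (B (Rle_refl 1)).
  replace (minus Y y) with (opp (dyadic_power s m y)) in B by (unfold Y; cvec V).
  rewrite (@norm_opp _ V) in B.
  assert (PY := norm_ge_0 Y).
  assert (B1 : K * norm (dyadic_power r m Y) <= 1 / 8 * norm Y).
  { replace (1 / 8 * norm Y) with (K * (/ (8 * K) * norm Y)) by (field; lra).
    apply Rmult_le_compat_l; [lra | apply Hm]. }
  assert (B2 : K * K * w * Rabs (r - s) * norm Y <= 1 / 8 * norm Y)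
    by (apply Rmult_le_compat_r; assumption).
  assert (B3 : norm Y <= norm y + norm (dyadic_power s m y)) by apply norm_minus_sum.
  assert (P := norm_ge_0 y). lra.
Qed.

(** The length of the steps is uniform, so finitely many of them lead from the trivial
    case [r = 0] to [r = 1]. *)
Lemma dyadic_small_one : dyadic_small 1 (1 / 2).
Proof.
  set (L := K * K * w).
  assert (PL : 0 < L) by (unfold L; repeat apply Rmult_lt_0_compat; assumption).
  set (d := / (8 * L)). assert (Pd : 0 < d) by (apply Rinv_0_lt_compat; lra).
  assert (H : forall j r, 0 <= r <= 1 -> r <= INR j * d -> dyadic_small r (1 / 2)).
  { induction j as [|j IH]; intros r Hr Hj.
    - simpl in Hj. replace r with 0 by lra. exists O. intros x. simpl.
      rewrite norm_complex_scal, Cmod_0. generalize (norm_ge_0 x). lra.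
    - rewrite S_INR in Hj. destruct (Rle_lt_dec r d) as [Hd | Hd].
      + apply (dyadic_small_step 0); [lra | exact Hr | |].
        * fold L. replace (1 / 8) with (L * d) by (unfold d; field; lra).
          apply Rmult_le_compat_l; [lra|]. rewrite Rabs_minus_sym, Rabs_pos_eq; lra.
        * apply IH; [lra|]. apply Rmult_le_pos; [apply pos_INR | lra].
      + apply (dyadic_small_step (r - d)); [lra | exact Hr | |].
        * fold L. replace (1 / 8) with (L * d) by (unfold d; field; lra).
          apply Rmult_le_compat_l; [lra|]. rewrite Rabs_minus_sym, Rabs_pos_eq; lra.
        * apply IH; lra. }
  destruct (INR_unbounded (/ d)) as [j Hj]. apply (H j); [lra|].
  replace 1 with (/ d * d) by (field; lra). apply Rmult_le_compat_r; lra.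
Qed.

End Doubling.

(** * Resolvent bounds from the spectrum *)

Section HalfPlane.

Context {V : NormedModule C_AbsRing}.
Variables (D : V -> V) (L : R).
Hypothesis L_pos : 0 < L.
Hypothesis D_bound : forall x, norm (D x) <= L * norm x.

Definition shift_bounded_below (K : R) (l : C) : Prop :=
  forall x : V, norm x <= K * norm (minus (D x) (scal l x)).

(** Spectral information enters through lower bounds rather than through inverses,
    because these survive small perturbations in a space which may be incomplete. *)
Lemma shift_bounded_below_perturb (K K' : R) (l l' : C) :
  0 < K -> K * Cmod (l - l') <= 1 / 2 -> 2 * K <= K' ->
  shift_bounded_below K l -> shift_bounded_below K' l'.
Proof.
  intros PK Hl HK' H x. assert (B := H x).
  replace (minus (D x) (scal l x)) with
    (minus (minus (D x) (scal l' x)) (scal (l - l')%C x)) in B by cvec V.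
  assert (T := norm_minus_sum (minus (D x) (scal l' x)) (scal (l - l')%C x)).
  rewrite norm_complex_scal in T.
  assert (Px := norm_ge_0 x). set (n := norm (minus (D x) (scal l' x))) in *.
  assert (Pn : 0 <= n) by apply norm_ge_0.
  apply (Rmult_le_compat_l K) in T; [|lra].
  apply (Rmult_le_compat_r (norm x)) in Hl; [|exact Px].
  apply Rle_trans with (2 * K * n); [|apply Rmult_le_compat_r; assumption]. lra.
Qed.

(** For large [l] the operator [D] is a small perturbation of [- l]. *)
Lemma shift_bounded_below_large (l : C) :
  2 * L <= Cmod l -> shift_bounded_below (/ L) l.
Proof.
  intros Hl x.
  assert (B : L * norm x <= norm (minus (D x) (scal l x))).
  { assert (T := norm_le_plus_minus (scal l x) (D x)).
    rewrite norm_minus_sym, norm_complex_scal in T. assert (Bx := D_bound x).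
    assert (2 * L * norm x <= Cmod l * norm x)
      by (apply Rmult_le_compat_r; [apply norm_ge_0 | exact Hl]).
    lra. }
  apply (Rmult_le_reg_l L); [exact L_pos|].
  rewrite <- Rmult_assoc, Rinv_r, Rmult_1_l by lra. exact B.
Qed.

(** The constant is locally bounded in [l], hence bounded on the compact rectangle that
    contains the part of the half-plane with [|l| <= 2 L]. *)
Lemma shift_bounded_below_uniform :
  (forall l, 0 <= Re l -> exists K, 0 < K /\ shift_bounded_below K l) ->
  exists K, 0 < K /\ forall l, 0 <= Re l -> shift_bounded_below K l.
Proof.
  intros H.
  assert (H' : forall a b, exists K, 0 < K /\ (0 <= a -> shift_bounded_below K (a, b))).
  { intros a b. destruct (Rle_lt_dec 0 a) as [Ha | Ha].
    - destruct (H (a, b) Ha) as [K [PK HK]]. exists K. auto.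
    - exists 1. split; [lra|]. intros H0. lra. }
  set (K := fun a b => proj1_sig (constructive_indefinite_description _ (H' a b))).
  assert (HK : forall a b, 0 < K a b /\ (0 <= a -> shift_bounded_below (K a b) (a, b))).
  { intros a b. exact (proj2_sig (constructive_indefinite_description _ (H' a b))). }
  assert (PK : forall a b, 0 < / (4 * K a b)).
  { intros a b. apply Rinv_0_lt_compat. generalize (proj1 (HK a b)). lra. }
  (* Coordinates closer than [1 / (4 K)] put the points at a distance below
     [1 / (2 K)], as [shift_bounded_below_perturb] requires. *)
  destruct (compactness_value_2d 0 (2 * L) (- (2 * L)) (2 * L)
    (fun a b => mkposreal _ (PK a b))) as [d Hd].
  assert (Pd := cond_pos d).
  assert (P2d : 0 < / (2 * d)) by (apply Rinv_0_lt_compat; lra).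
  assert (PL : 0 < / L) by (apply Rinv_0_lt_compat; lra).
  exists (/ (2 * d) + / L). split; [lra|]. intros l Hl.
  assert (Mono : forall k, k <= / (2 * d) + / L -> shift_bounded_below k l ->
    shift_bounded_below (/ (2 * d) + / L) l).
  { intros k Hk Hb x. eapply Rle_trans; [apply Hb|].
    apply Rmult_le_compat_r; [apply norm_ge_0 | exact Hk]. }
  destruct (Rle_lt_dec (2 * L) (Cmod l)) as [Hbig | Hsmall].
  - apply (Mono (/ L)); [lra|]. apply shift_bounded_below_large, Hbig.
  - assert (B1 := Rabs_def2 _ _ (Rle_lt_trans _ _ _ (Re_le_Cmod l) Hsmall)).
    assert (B2 := Rabs_def2 _ _ (Rle_lt_trans _ _ _ (Im_le_Cmod l) Hsmall)).
    destruct l as [a b]. simpl in Hl, B1, B2.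
    apply (Mono (/ (2 * d))); [lra|]. apply NNPP. intros Hn.
    apply (Hd a b); [lra | lra |]. intros [u [v [Hu [Hv [Hau [Hbv Hduv]]]]]].
    apply Hn. clear Hn. simpl in Hau, Hbv, Hduv.
    destruct (HK u v) as [Pk Hk]. specialize (Hk (proj1 Hu)).
    apply (shift_bounded_below_perturb (K u v) _ (u, v)); [exact Pk| | |exact Hk].
    + assert (T := Cmod_triangle (RtoC (u - a)) (Ci * RtoC (v - b))).
      replace (RtoC (u - a) + Ci * RtoC (v - b))%C with ((u, v) - (a, b))%C in T
        by (apply injective_projections; simpl; ring).
      rewrite Cmod_mult, Cmod_Ci, !Cmod_R in T.
      rewrite (Rabs_minus_sym u a), (Rabs_minus_sym v b) in T.
      replace (1 / 2) with (K u v * (2 * / (4 * K u v))) by (field; lra).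
      apply Rmult_le_compat_l; lra.
    + apply (Rmult_le_reg_r (2 * d)); [lra|]. rewrite Rinv_l by lra.
      apply (Rmult_le_compat_l (4 * K u v)) in Hduv; [|lra].
      rewrite Rinv_r in Hduv by lra. lra.
Qed.

(** The identity [1 - mu (1 + h D) = - mu h (D - l)] holds for [l = (1 / mu - 1) / h],
    and [|mu| <= 1] means [|1 + h l| >= 1].  This confines [l] to the outside of a
    disc in the left half-plane which touches the imaginary axis at 0 and whose radius
    [1 / h] grows as [h] tends to 0. *)
Lemma inverse_shift_re (mu : C) (h : R) : 0 < h -> mu <> 0%C -> Cmod mu <= 1 ->
  let l := ((/ mu - 1) / RtoC h)%C in - h * (Cmod l * Cmod l) / 2 <= Re l.
Proof.
  intros Ph Hmu H1 l.
  assert (E : (/ mu)%C = (1 + RtoC h * l)%C).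
  { unfold l. field. split; [exact Hmu|]. intros H. apply RtoC_inj in H. lra. }
  assert (Hi : 1 <= Cmod (/ mu)).
  { rewrite Cmod_inv by exact Hmu. rewrite <- Rinv_1. apply Rinv_le_contravar; [|exact H1].
    apply Cmod_gt_0, Hmu. }
  rewrite E in Hi.
  assert (A1 := Cmod2_alt (1 + RtoC h * l)). assert (A2 := Cmod2_alt l).
  destruct l as [a b]. simpl in A1, A2 |- *.
  set (m := Cmod (a, b)) in *. set (n := Cmod (1 + RtoC h * (a, b))) in *.
  assert (Hn : 1 <= n * n) by nra.
  apply (f_equal (Rmult (h * h))) in A2.
  assert (Hnn : 1 <= 1 + 2 * h * a + h * h * (m * m)) by lra.
  apply (Rmult_le_reg_l (2 * h)); [lra|]. lra.
Qed.

(** In the notation of [inverse_shift_re], a bounded [l] has [Re l >= - 2 h L ^ 2] and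
    is thus, for small [h], a small perturbation of a point of the right half-plane.
    The bound obtained for [D - l] is divided by [|mu| h]; therefore small [mu], for
    which [1 - mu W] is close to 1, are treated apart. *)
Lemma euler_bounded_below (K : R) : 0 < K ->
  (forall l, 0 <= Re l -> shift_bounded_below K l) ->
  exists h K', 0 < h /\ 0 < K' /\ forall (mu : C) (x : V), Cmod mu <= 1 ->
    norm x <= K' * norm (minus x (scal mu (plus x (scal (RtoC h) (D x))))).
Proof.
  (* [K * (2 h L ^ 2) = 1 / 2] is the largest perturbation allowed. *)
  intros PK HK. set (h := / (4 * L * L * K)).
  assert (PL2 : 0 < L * L) by (apply Rmult_lt_0_compat; assumption).
  assert (PL2K : 0 < L * L * K) by (apply Rmult_lt_0_compat; assumption).
  assert (Ph : 0 < h) by (apply Rinv_0_lt_compat; lra).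
  set (w := 1 + h * L). assert (Pw : 0 < h * L) by (apply Rmult_lt_0_compat; assumption).
  set (k := 2 * K + / L). assert (PL : 0 < / L) by (apply Rinv_0_lt_compat; lra).
  assert (Pkw : 0 < k * (2 * w) / h).
  { apply Rdiv_lt_0_compat; [|exact Ph]. apply Rmult_lt_0_compat; unfold k, w; lra. }
  exists h, (2 + k * (2 * w) / h). split; [exact Ph|]. split; [lra|].
  intros mu x Hmu. set (y := minus x _). assert (Py := norm_ge_0 y).
  assert (Px := norm_ge_0 x). assert (Pm := Cmod_ge_0 mu).
  destruct (Rle_lt_dec (Cmod mu * w) (1 / 2)) as [Hs | Hs].
  - assert (Bx : norm x <= 2 * norm y).
    { assert (T := norm_le_plus_minus x y).
      replace (minus x y) with (scal mu (plus x (scal (RtoC h) (D x)))) in T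
        by (unfold y; cvec V).
      rewrite norm_complex_scal in T.
      assert (T2 : norm (plus x (scal (RtoC h) (D x))) <= w * norm x).
      { eapply Rle_trans; [apply (@norm_triangle _ V)|].
        rewrite norm_complex_scal, Cmod_R, Rabs_pos_eq by lra.
        assert (Bd := D_bound x). apply (Rmult_le_compat_l h) in Bd; [|lra].
        unfold w. lra. }
      apply (Rmult_le_compat_l (Cmod mu)) in T2; [|exact Pm].
      apply (Rmult_le_compat_r (norm x)) in Hs; [|exact Px]. lra. }
    assert (0 <= k * (2 * w) / h * norm y) by (apply Rmult_le_pos; lra). lra.
  - assert (Hm0 : 0 < Cmod mu).
    { destruct Pm as [Pm | Pm]; [exact Pm|]. rewrite <- Pm in Hs. lra. }
    assert (Hmu0 : mu <> 0%C) by (apply Cmod_gt_0, Hm0).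
    assert (Hh0 : RtoC h <> 0%C) by (intros H; apply RtoC_inj in H; lra).
    set (l := ((/ mu - 1) / RtoC h)%C).
    assert (Re_l : - h * (Cmod l * Cmod l) / 2 <= Re l)
      by exact (inverse_shift_re mu h Ph Hmu0 Hmu).
    assert (Bl : shift_bounded_below k l).
    { destruct (Rle_lt_dec (2 * L) (Cmod l)) as [Hbig | Hsmall].
      - intros z. eapply Rle_trans; [apply shift_bounded_below_large, Hbig|].
        apply Rmult_le_compat_r; [apply norm_ge_0 | unfold k; lra].
      - assert (Pl := Cmod_ge_0 l).
        assert (Hll : Cmod l * Cmod l <= 4 * (L * L)) by nra.
        assert (Hre : - (2 * h * (L * L)) <= Re l).
        { apply (Rmult_le_compat_l h) in Hll; lra. }
        apply (shift_bounded_below_perturb K _ (Rmax 0 (Re l), Im l)).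
        + exact PK.
        + replace ((Rmax 0 (Re l), Im l) - l)%C with (RtoC (Rmax 0 (Re l) - Re l)).
          2:{ destruct l as [a b]. apply injective_projections; simpl; ring. }
          rewrite Cmod_R.
          apply Rle_trans with (K * (2 * h * (L * L))).
          * apply Rmult_le_compat_l; [lra|].
            assert (0 <= 2 * h * (L * L)) by (apply Rmult_le_pos; lra).
            apply Rabs_le. unfold Rmax. destruct (Rle_dec 0 (Re l)); lra.
          * right. unfold h. field. lra.
        + unfold k. lra.
        + apply HK. apply Rmax_l. }
    assert (Ey : minus (D x) (scal l x) = opp (scal (/ (mu * RtoC h))%C y)).
    { unfold y, l. cvec_coefs V; field; split; assumption. }
    assert (B := Bl x).
    rewrite Ey, (@norm_opp _ V), norm_complex_scal in B.
    rewrite Cmod_inv, Cmod_mult, Cmod_R, (Rabs_pos_eq h) in B by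
      (try lra; apply Cmult_neq_0; assumption).
    assert (Him : / Cmod mu <= 2 * w).
    { apply (Rmult_le_reg_l (Cmod mu)); [exact Hm0|]. rewrite Rinv_r by lra. lra. }
    apply Rle_trans with (k * (2 * w) / h * norm y); [|lra].
    eapply Rle_trans; [exact B|]. rewrite Rinv_mult.
    replace (k * (/ Cmod mu * / h * norm y)) with (/ Cmod mu * (k * / h * norm y)) by ring.
    replace (k * (2 * w) / h * norm y) with (2 * w * (k * / h * norm y)) by (unfold Rdiv; ring).
    apply Rmult_le_compat_r; [|exact Him].
    assert (0 < / h) by (apply Rinv_0_lt_compat, Ph).
    repeat apply Rmult_le_pos; try lra. unfold k. lra.
Qed.

End HalfPlane.

(** * Exponential decay *)

Section Contractions.

Context {V : NormedModule R_AbsRing}.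

(** [T] is a strict contraction for a sublinear functional equivalent to the norm. *)
Definition contracts (T : V -> V) : Prop :=
  exists (q : V -> R) (c theta : R), 0 < c /\ 0 < theta < 1 /\
    (forall x y, q (plus x y) <= q x + q y) /\
    (forall (a : R) x, 0 <= a -> q (scal a x) <= a * q x) /\
    (forall x, norm x <= q x <= c * norm x) /\
    (forall x, q (T x) <= theta * q x).

Lemma contracts_ext (T T' : V -> V) :
  (forall x, T x = T' x) -> contracts T -> contracts T'.
Proof.
  intros E [q [c [theta [Pc [Pt [Hp [Hs [Hn HT]]]]]]]].
  exists q, c, theta. repeat split; try tauto; try apply Hn. intros x.
  rewrite <- E. apply HT.
Qed.

Lemma contracts_half (T : V -> V) :
  (forall x, norm (T x) <= 1 / 2 * norm x) -> contracts T.
Proof.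
  intros H. exists (@norm _ V), 1, (1 / 2).
  split; [lra|]. split; [lra|]. split; [apply (@norm_triangle _ V)|].
  split.
  { intros a x Ha. rewrite norm_real_scal, Rabs_pos_eq by exact Ha. lra. }
  split; [|exact H]. intros x. lra.
Qed.

(** If [T ^ 2] contracts [q] by [theta], then [T] contracts
    [q x + q (T x) / sqrt theta] by [sqrt theta]. *)
Lemma contracts_square (T : V -> V) :
  is_linear T -> contracts (fun x => T (T x)) -> contracts T.
Proof.
  intros HT [q [c [theta [Pc [[Pt Pt1] [Hp [Hs [Hn Hc]]]]]]]].
  destruct (linear_norm T HT) as [m [Pm Hm]].
  set (r := sqrt theta).
  assert (Pr : 0 < r) by (apply sqrt_lt_R0; exact Pt).
  assert (Er : r * r = theta) by (apply sqrt_sqrt; lra).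
  assert (Hr1 : r < 1) by (apply Rnot_le_lt; intros H; nra).
  assert (Pir : 0 < / r) by (apply Rinv_0_lt_compat, Pr).
  exists (fun x => q x + / r * q (T x)), (c + / r * (c * m)), r.
  assert (Pcm : 0 < / r * (c * m)) by (repeat apply Rmult_lt_0_compat; assumption).
  split; [lra|]. split; [lra|]. split; [|split; [|split]].
  - intros x y. rewrite (linear_plus T HT).
    assert (A := Hp x y). assert (B := Hp (T x) (T y)).
    apply (Rmult_le_compat_l (/ r)) in B; lra.
  - intros a x Ha. replace (T (scal a x)) with (scal a (T x)).
    2:{ symmetry. apply (linear_scal T HT a x). }
    assert (A := Hs a x Ha). assert (B := Hs a (T x) Ha).
    apply (Rmult_le_compat_l (/ r)) in B; lra.
  - intros x. destruct (Hn x) as [A1 A2]. destruct (Hn (T x)) as [B1 B2].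
    assert (B0 := norm_ge_0 (T x)).
    assert (0 <= / r * q (T x)) by (apply Rmult_le_pos; lra).
    split; [lra|]. assert (M := Hm x).
    apply (Rmult_le_compat_l c) in M; [|lra].
    assert (B3 : q (T x) <= c * (m * norm x)) by lra.
    apply (Rmult_le_compat_l (/ r)) in B3; lra.
  - intros x. assert (A := Hc x). rewrite <- Er in A.
    apply (Rmult_le_compat_l (/ r)) in A; [|lra].
    replace (/ r * (r * r * q x)) with (r * q x) in A by (field; lra).
    replace (r * (q x + / r * q (T x))) with (r * q x + q (T x)) by (field; lra).
    lra.
Qed.

(** A step of length [k < h] of [u' = D u] is a convex combination of the identity and
    the contraction [1 + h D], so it shrinks [q] by the factor [1 - (1 - theta) k / h]. *)
Lemma exponential_decay (D : V -> V) (h : R) :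
  0 < h -> contracts (fun x => plus x (scal h (D x))) ->
  exists c a, 0 < c /\ 0 < a /\
    forall u : R -> V, (forall t, 0 <= t -> half_deriv u t (D (u t))) ->
      forall t, 0 <= t -> norm (u t) <= c * norm (u 0) * exp (- (a * t)).
Proof.
  intros Ph [q [c [theta [Pc [[Pt Pt1] [Hp [Hs [Hn Hc]]]]]]]].
  assert (Pih : 0 < / h) by (apply Rinv_0_lt_compat, Ph).
  assert (Pa : 0 < (1 - theta) * / h) by (apply Rmult_lt_0_compat; lra).
  exists c, ((1 - theta) * / h / 2). split; [exact Pc|]. split; [lra|].
  intros u Hu t Ht.
  eapply Rle_trans; [apply (proj1 (Hn (u t)))|].
  eapply Rle_trans.
  - apply (seminorm_growth q c (- ((1 - theta) * / h)) (- ((1 - theta) * / h / 2)) h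
      u (fun t => D (u t))); try assumption; try lra.
    + intros x. assert (H := Hn x). generalize (norm_ge_0 x). lra.
    + intros r k Hr [Hk Hkh].
      assert (Hk1 : k * / h <= 1).
      { apply (Rmult_le_reg_r h); [exact Ph|].
        rewrite Rmult_assoc, Rinv_l by lra. lra. }
      assert (Hk0 : 0 <= k * / h) by (apply Rmult_le_pos; lra).
      replace (plus (u r) (scal k (D (u r)))) with
        (plus (scal (1 - k * / h) (u r))
              (scal (k * / h) (plus (u r) (scal h (D (u r)))))) by vec V.
      eapply Rle_trans; [apply Hp|].
      assert (A := Hs (1 - k * / h) (u r) ltac:(lra)).
      assert (B := Hs (k * / h) (plus (u r) (scal h (D (u r)))) Hk0).
      assert (E := Hc (u r)). apply (Rmult_le_compat_l (k * / h)) in E; [|exact Hk0].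
      lra.
  - replace (- ((1 - theta) * / h / 2) * t) with (- ((1 - theta) * / h / 2 * t)) by ring.
    apply Rmult_le_compat_r; [left; apply exp_pos|]. apply Hn.
Qed.

End Contractions.

Lemma dyadic_contracts {V : NormedModule C_AbsRing} (W : V -> V) :
  is_linear W -> dyadic_small W 1 (1 / 2) -> @contracts (@realify Complexes V) W.
Proof.
  intros HW [m Hm]. set (Vr := @realify Complexes V).
  assert (HWr : @is_linear _ Vr Vr W) by exact (@realify_is_linear Complexes V V W HW).
  assert (E0 : forall x, W x = dyadic_power W 1 0 x).
  { intros x. simpl. cvec V. }
  assert (Hlin : forall m, @is_linear _ Vr Vr (dyadic_power W 1 m)).
  { intros n. induction n as [|n IH].
    - apply (@is_linear_ext _ Vr Vr W); [exact E0 | exact HWr].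
    - exact (@is_linear_comp _ Vr Vr Vr _ _ IH IH). }
  assert (H : @contracts Vr (dyadic_power W 1 m)) by (apply contracts_half; exact Hm).
  clear Hm. induction m as [|m IH].
  - revert H. apply contracts_ext. intros x. symmetry. apply E0.
  - apply IH. apply contracts_square; [apply Hlin | exact H].
Qed.

(** The spectrum of [T] off the closed right half-plane makes [D - l] bounded below
    there, because the inversion [l -> 1 / l] preserves this half-plane. *)
Lemma stable_spectrum_contracts_complex {V : NormedModule C_AbsRing} (T D : V -> V) :
  is_linear T -> is_linear D ->
  (forall x, D (T x) = x) -> (forall x, T (D x) = x) ->
  (forall l, complex_spectrum V T l -> Re l < 0) ->
  exists h, 0 < h /\
    @contracts (@realify Complexes V) (fun x => plus x (scal (RtoC h) (D x))).
Proof.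
  intros HT HD DT TD Hspec.
  destruct (linear_norm T HT) as [t [Pt Ht]]. destruct (linear_norm D HD) as [L [PL HL]].
  assert (Hbelow : forall l, 0 <= Re l -> exists K, 0 < K /\ shift_bounded_below D K l).
  { intros l Hl. destruct (Ceq_dec l 0) as [-> | Hl0].
    - exists t. split; [exact Pt|]. intros x.
      replace (minus (D x) (scal (RtoC 0) x)) with (D x) by cvec V.
      rewrite <- (TD x) at 1. apply Ht.
    - assert (Hinv : invertible (fun x => minus (T x) (scal (/ l)%C x))).
      { apply NNPP. intros H. apply Hspec in H. revert H. apply Rle_not_lt.
        destruct l as [a b]. simpl in Hl |- *.
        assert (P : 0 < a * (a * 1) + b * (b * 1)).
        { assert (N := Cmod2_alt (a, b)). simpl in N. rewrite <- N.
          apply Cmod_gt_0 in Hl0. rewrite Rmult_1_r. apply Rmult_lt_0_compat; exact Hl0. }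
        apply Rmult_le_pos; [exact Hl|]. left. apply Rinv_0_lt_compat, P. }
      destruct Hinv as [S [HS [HSl _]]]. destruct (linear_norm S HS) as [k [Pk Hk]].
      assert (Pl : 0 < Cmod l) by (apply Cmod_gt_0, Hl0).
      assert (Pil : 0 < / Cmod l) by (apply Rinv_0_lt_compat, Pl).
      exists (t * (k * / Cmod l)). split.
      { repeat apply Rmult_lt_0_compat; assumption. }
      intros x.
      (* With [x = T z] the shift of [D] by [l] becomes that of [T] by [1 / l]. *)
      assert (Bz : norm (D x) <= k * / Cmod l * norm (minus (D x) (scal l x))).
      { rewrite <- (HSl (D x)) at 1. eapply Rle_trans; [apply Hk|].
        rewrite Rmult_assoc. apply Rmult_le_compat_l; [lra|].
        rewrite TD.
        replace (minus x (scal (/ l)%C (D x))) with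
          (scal (- / l)%C (minus (D x) (scal l x))).
        - rewrite norm_complex_scal, Cmod_opp, Cmod_inv by exact Hl0. lra.
        - cvec_coefs V; field; assumption. }
      rewrite <- (TD x) at 1. eapply Rle_trans; [apply Ht|].
      apply (Rmult_le_compat_l t) in Bz; lra. }
  destruct (shift_bounded_below_uniform D L PL HL Hbelow) as [K [PK HK]].
  destruct (euler_bounded_below D L PL HL K PK HK) as [h [K' [Ph [PK' HE]]]].
  exists h. split; [exact Ph|].
  set (W := fun x => plus x (scal (RtoC h) (D x))).
  assert (HW : is_linear W).
  { constructor.
    - intros x y. unfold W. rewrite (linear_plus D HD). cvec V.
    - intros k x. unfold W.
      replace (D (scal k x)) with (scal k (D x)) by (symmetry; apply (linear_scal D HD)).
      cvec V.
    - exists (1 + h * L). assert (0 < h * L) by (apply Rmult_lt_0_compat; assumption).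
      split; [lra|]. intros x. unfold W. eapply Rle_trans; [apply (@norm_triangle _ V)|].
      rewrite norm_complex_scal, Cmod_R, Rabs_pos_eq by lra.
      assert (B := HL x). apply (Rmult_le_compat_l h) in B; lra. }
  apply dyadic_contracts; [exact HW|].
  destruct (linear_norm W HW) as [w [Pw Hw]].
  apply (dyadic_small_one W w K' HW Pw Hw PK'). exact HE.
Qed.

Section RealSpectrum.

Context {V : NormedModule R_AbsRing}.

Lemma complexify_is_linear (T : V -> V) : is_linear T -> is_linear (complexify V T).
Proof.
  intros HT. constructor.
  - intros [x1 x2] [y1 y2].
    exact (f_equal2 pair (linear_plus T HT x1 y1) (linear_plus T HT x2 y2)).
  - intros [a b] [x1 x2].
    change ((T (minus (scal a x1) (scal b x2)), T (plus (scal a x2) (scal b x1))) =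
      (minus (scal a (T x1)) (scal b (T x2)), plus (scal a (T x2)) (scal b (T x1)))).
    assert (S : forall (k : R) x, T (scal k x) = scal k (T x)) by exact (linear_scal T HT).
    rewrite (linear_minus T _ _ HT), (linear_plus T HT), !S. reflexivity.
  - destruct (linear_norm T HT) as [m [Pm Hm]]. exists (2 * m). split; [lra|].
    intros [x1 x2]. change (cplx_norm V (T x1, T x2) <= 2 * m * cplx_norm V (x1, x2)).
    eapply Rle_trans; [apply cplx_norm_le_sum|]. simpl.
    assert (A1 := cplx_norm_fst V (x1, x2)). assert (A2 := cplx_norm_snd V (x1, x2)).
    simpl in A1, A2.
    apply (Rmult_le_compat_l m) in A1; [|lra]. apply (Rmult_le_compat_l m) in A2; [|lra].
    assert (B1 := Hm x1). assert (B2 := Hm x2). lra.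
Qed.

(** A functional on the complexification which [1 + h D] contracts restricts to the
    real vectors [x + i 0]. *)
Lemma stable_spectrum_contracts_real (T D : V -> V) :
  is_linear T -> is_linear D ->
  (forall x, D (T x) = x) -> (forall x, T (D x) = x) ->
  (forall l, complex_spectrum (complexification V) (complexify V T) l -> Re l < 0) ->
  exists h : R, 0 < h /\ contracts (fun x => plus x (scal h (D x))).
Proof.
  intros HT HD DT TD Hspec.
  destruct (stable_spectrum_contracts_complex (complexify V T) (complexify V D))
    as [h [Ph [q [c [theta [Pc [Pt [Hp [Hs [Hn Hc]]]]]]]]]].
  - apply complexify_is_linear, HT.
  - apply complexify_is_linear, HD.
  - intros [x y]. unfold complexify. simpl. rewrite !DT. reflexivity.
  - intros [x y]. unfold complexify. simpl. rewrite !TD. reflexivity.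
  - exact Hspec.
  - exists h. split; [exact Ph|].
    assert (N : forall x : V, norm x <= cplx_norm V (x, zero) <= norm x).
    { intros x. split; [exact (cplx_norm_fst V (x, zero))|].
      eapply Rle_trans; [apply cplx_norm_le_sum|]. simpl.
      rewrite (@norm_zero _ V). lra. }
    exists (fun x => q (x, zero)), c, theta.
    split; [exact Pc|]. split; [exact Pt|]. split; [|split; [|split]].
    + intros x y. assert (A := Hp (x, zero) (y, zero)).
      change (q (plus x y, plus zero zero) <= q (x, zero) + q (y, zero)) in A.
      replace (@plus V zero zero) with (@zero V) in A by vec V. exact A.
    + intros a x Ha. assert (A := Hs a (x, zero) Ha).
      change (q (minus (scal a x) (scal 0 (@zero V)), plus (scal a (@zero V)) (scal 0 x))
              <= a * q (x, zero)) in A.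
      replace (minus (scal a x) (scal 0 (@zero V))) with (scal a x) in A by vec V.
      replace (plus (scal a (@zero V)) (scal 0 x)) with (@zero V) in A by vec V.
      exact A.
    + intros x. assert (A := Hn (x, zero)).
      change (cplx_norm V (x, zero) <= q (x, zero) <= c * cplx_norm V (x, zero)) in A.
      assert (Nx := N x). split; [lra|].
      eapply Rle_trans; [apply A|]. apply Rmult_le_compat_l; lra.
    + intros x. assert (A := Hc (x, zero)).
      change (q (plus x (minus (scal h (D x)) (scal 0 (D (@zero V)))),
                 plus (@zero V) (plus (scal h (D (@zero V))) (scal 0 (D x))))
              <= theta * q (x, zero)) in A.
      rewrite (linear_zero D HD) in A.
      replace (minus (scal h (D x)) (scal 0 (@zero V))) with (scal h (D x)) in A by vec V.
      replace (plus (@zero V) (plus (scal h (@zero V)) (scal 0 (D x)))) with (@zero V)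
        in A by vec V.
      exact A.
Qed.

End RealSpectrum.

Lemma stable_spectrum_contracts {s : scalar_field} {V : NormedModule (scalars s)}
    (T D : V -> V) :
  is_linear T -> is_linear D ->
  (forall x, D (T x) = x) -> (forall x, T (D x) = x) ->
  (forall l, spectrum V T l -> Re l < 0) ->
  exists h : R, 0 < h /\
    @contracts (realify V)
      (fun x => @plus (realify V) x (@scal _ (realify V) h (D x))).
Proof.
  destruct s; intros HT HD DT TD Hspec.
  - exact (stable_spectrum_contracts_real T D HT HD DT TD Hspec).
  - exact (stable_spectrum_contracts_complex T D HT HD DT TD Hspec).
Qed.

(** * The equation [B x' = x + f] for an operator intertwined with an invertible one *)

Lemma iter_linear {K : AbsRing} {V : NormedModule K} (T : V -> V) (n : nat) :
  is_linear T -> is_linear (fun x => Nat.iter n T x).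
Proof.
  intros HT. induction n as [|n IH]; simpl.
  - apply is_linear_id.
  - exact (is_linear_comp _ _ IH HT).
Qed.

Lemma iter_semiconj {U V : Type} (f : U -> U) (g : V -> V) (h : U -> V) :
  (forall x, h (f x) = g (h x)) -> forall n x, h (Nat.iter n f x) = Nat.iter n g (h x).
Proof.
  intros H n x. induction n as [|n IH]; simpl; [reflexivity|]. rewrite H, IH. reflexivity.
Qed.

Lemma iter_cancel {U : Type} (f g : U -> U) :
  (forall x, g (f x) = x) -> forall n x, Nat.iter n g (Nat.iter n f x) = x.
Proof.
  intros H n. induction n as [|n IH]; intros x; [reflexivity|].
  rewrite Nat.iter_succ_r. simpl. rewrite H. apply IH.
Qed.

Section Intertwining.

Context {X Z : NormedModule R_AbsRing}.
Variables (B : X -> X) (M : X -> Z) (N : Z -> X) (T D : Z -> Z) (p : nat).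
Hypothesis B_linear : is_linear B.
Hypothesis M_linear : is_linear M.
Hypothesis N_linear : is_linear N.
Hypothesis D_linear : is_linear D.
Hypothesis DT : forall z, D (T z) = z.
Hypothesis TD : forall z, T (D z) = z.
Hypothesis MB : forall x, M (B x) = T (M x).
Hypothesis BN : forall z, B (N z) = N (T z).
Hypothesis NM : forall x, N (M x) = Nat.iter p B x.
Hypothesis MN : forall z, M (N z) = Nat.iter p T z.

Definition lift (z : Z) : X := N (Nat.iter p D z).

(** The projection onto the range of [N] along the kernel of [M]. *)
Definition proj (x : X) : X := lift (M x).

Lemma lift_linear : is_linear lift.
Proof. exact (is_linear_comp _ _ (iter_linear D p D_linear) N_linear). Qed.

Lemma proj_linear : is_linear proj.
Proof. exact (is_linear_comp _ _ M_linear lift_linear). Qed.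

Lemma M_lift z : M (lift z) = z.
Proof. unfold lift. rewrite MN. apply iter_cancel, TD. Qed.

Lemma lift_M_N z : lift (M (N z)) = N z.
Proof. unfold lift. rewrite MN, iter_cancel by exact DT. reflexivity. Qed.

Lemma B_lift z : B (lift z) = lift (T z).
Proof.
  unfold lift. rewrite BN. f_equal.
  rewrite <- (iter_semiconj D D T); [reflexivity|]. intros y. rewrite TD, DT. reflexivity.
Qed.

Lemma B_proj x : B (proj x) = proj (B x).
Proof. unfold proj. rewrite B_lift, MB. reflexivity. Qed.

(** [B ^ p] maps into the range of [proj]: this is the nilpotency of [B] on the
    complementary part. *)
Lemma proj_iter x : proj (Nat.iter p B x) = Nat.iter p B x.
Proof. rewrite <- NM. unfold proj. rewrite lift_M_N. reflexivity. Qed.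

Definition homogeneous (w : R -> X) : Prop :=
  forall t, 0 <= t -> exists dw, half_deriv w t dw /\ B dw = w t.

Lemma homogeneous_M w : homogeneous w ->
  forall t, 0 <= t -> half_deriv (fun t => M (w t)) t (D (M (w t))).
Proof.
  intros Hw t Ht. destruct (Hw t Ht) as [dw [Hd HB]].
  rewrite <- HB, MB, DT. apply (@half_deriv_linear X Z); assumption.
Qed.

(** Gronwall's inequality settles the part seen by [M]; what remains is killed by a
    power of [B]. *)
Lemma homogeneous_zero w : homogeneous w -> M (w 0) = zero ->
  forall t, 0 <= t -> w t = zero.
Proof.
  intros Hw H0.
  assert (HM := linear_ode_zero D (fun t => M (w t)) D_linear (homogeneous_M w Hw) H0).
  assert (Hp : forall t, 0 <= t -> Nat.iter p B (w t) = zero).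
  { intros t Ht. rewrite <- NM, HM by exact Ht. apply (linear_zero N N_linear). }
  revert Hp. generalize p. intros n. induction n as [|n IH]; intros Hn; [exact Hn|].
  apply IH. intros t Ht. destruct (Hw t Ht) as [dw [Hd HB]].
  (* Differentiating [B ^ (n + 1) w = 0] lowers the exponent, because [B w' = w]. *)
  assert (H1 := half_deriv_linear _ _ _ _ (iter_linear B (S n) B_linear) Hd).
  rewrite Nat.iter_succ_r, HB in H1.
  apply (half_deriv_unique (fun _ => @zero X) t); [exact Ht| |
    exact (half_deriv_const (V := X) zero t)].
  revert H1. apply half_deriv_ext; [|exact Ht]. intros r Hr. apply Hn, Hr.
Qed.

Lemma homogeneous_minus v w : homogeneous v -> homogeneous w ->
  homogeneous (fun t => minus (v t) (w t)).
Proof.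
  intros Hv Hw t Ht. destruct (Hv t Ht) as [dv [Dv Bv]]. destruct (Hw t Ht) as [dw [Dw Bw]].
  exists (minus dv dw). split; [apply half_deriv_minus; assumption|].
  rewrite (linear_minus B _ _ B_linear), Bv, Bw. reflexivity.
Qed.

Lemma homogeneous_proj w : homogeneous w -> homogeneous (fun t => proj (w t)).
Proof.
  intros Hw t Ht. destruct (Hw t Ht) as [dw [Dw Bw]].
  exists (proj dw). split.
  - apply (@half_deriv_linear X X); [apply proj_linear | exact Dw].
  - rewrite B_proj, Bw. reflexivity.
Qed.

(** The difference of the two sides solves the homogeneous equation and is annihilated
    by [M]. *)
Lemma homogeneous_eq_lift w : homogeneous w -> forall t, 0 <= t -> w t = lift (M (w t)).
Proof.
  intros Hw t Ht. apply minus_eq_zero_eq.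
  apply (homogeneous_zero (fun t => minus (w t) (proj (w t)))); [| |exact Ht].
  - apply homogeneous_minus; [exact Hw | apply homogeneous_proj, Hw].
  - rewrite (linear_minus M _ _ M_linear). unfold proj. rewrite M_lift. vec Z.
Qed.

Fixpoint half_differentiable (n : nat) (f : R -> X) : Prop :=
  match n with
  | O => True
  | S n => exists g : R -> X,
      (forall t, 0 <= t -> half_deriv f t (g t)) /\ half_differentiable n g
  end.

(** If [y] solves the equation with right-hand side [f'] up to the range of [B ^ n], then
    [B y - f] solves it with right-hand side [f] up to the range of [B ^ (n + 1)]. *)
Lemma solution_modulo_power n f : half_differentiable n f ->
  exists y, forall t, 0 <= t -> exists dy r, half_deriv y t dy /\
    B dy = plus (plus (y t) (f t)) (Nat.iter n B r).
Proof.
  revert f. induction n as [|n IH]; intros f Hf.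
  - exists (fun _ => zero). intros t Ht. exists zero, (opp (f t)).
    split; [exact (half_deriv_const (V := X) zero t)|].
    rewrite (linear_zero B B_linear). simpl. vec X.
  - destruct Hf as [g [Hg Hgn]]. destruct (IH g Hgn) as [y Hy].
    exists (fun t => minus (B (y t)) (f t)). intros t Ht.
    destruct (Hy t Ht) as [dy [r [Hd HB]]]. exists (minus (B dy) (g t)), r. split.
    + apply half_deriv_minus; [|apply Hg, Ht].
      apply (@half_deriv_linear X X); assumption.
    + replace (minus (B dy) (g t)) with (plus (y t) (Nat.iter n B r)).
      * rewrite (linear_plus B B_linear). simpl. vec X.
      * rewrite HB. vec X.
Qed.

(** The part of [y] in the kernel of [proj] is an exact solution there, by
    [proj_iter]; it is completed by the solution [z] on the range of [proj]. *)
Lemma solution_exists f c : linear_ode_solvable X -> (1 <= p)%nat -> half_differentiable p f ->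
  exists x, (forall t, 0 <= t -> exists dx, half_deriv x t dx /\ B dx = plus (x t) (f t)) /\
    M (x 0) = c.
Proof.
  intros Hode Hp Hf. destruct (solution_modulo_power p f Hf) as [y Hy].
  assert (Hg : exists g, forall t, 0 <= t -> half_deriv f t (g t)).
  { destruct p as [|p']; [lia|]. destruct Hf as [g [Hg _]]. exists g. exact Hg. }
  destruct Hg as [g Hg]. set (E := fun x => lift (D (M x))).
  assert (HE : is_linear E).
  { exact (is_linear_comp _ _ (is_linear_comp _ _ M_linear D_linear) lift_linear). }
  destruct (Hode E (fun t => E (f t)) (fun t => E (g t)) (lift c) HE)
    as [z [Hz0 Hz]].
  { intros t Ht. apply (@half_deriv_linear X X); [exact HE | apply Hg, Ht]. }
  exists (fun t => plus (minus (y t) (proj (y t))) (proj (z t))). split.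
  - intros t Ht. destruct (Hy t Ht) as [dy [r [Dy By]]].
    assert (BE : forall x, B (proj (E x)) = proj x).
    { intros x. unfold E, proj. rewrite M_lift, B_lift, TD. reflexivity. }
    eexists. split.
    + apply half_deriv_plus; [exact Ht | apply half_deriv_minus; [exact Dy|]|].
      * apply (@half_deriv_linear X X); [apply proj_linear | exact Dy].
      * apply (@half_deriv_linear X X); [apply proj_linear | exact (Hz t Ht)].
    + rewrite (linear_plus B B_linear), (linear_minus B _ _ B_linear), B_proj.
      rewrite (linear_plus proj proj_linear), (linear_plus B B_linear), !BE, By.
      rewrite !(linear_plus proj proj_linear), proj_iter. vec X.
  - rewrite Hz0, (linear_plus M M_linear), (linear_minus M _ _ M_linear).
    unfold proj. rewrite !M_lift. vec Z.
Qed.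

End Intertwining.

(** * Skeleton chains *)

Section Chain.

Context {s : scalar_field} {X : CompleteNormedModule (scalars s)}.
Context {Y : nat -> NormedModule (scalars s)}.
Variable B : chain_space X Y 0 -> chain_space X Y 0.
Variable Aup : forall i, chain_space X Y i -> chain_space X Y (S i).
Variable Adown : forall i, chain_space X Y (S i) -> chain_space X Y i.
Variable p : nat.
Hypothesis chain : skeleton_chain B Aup Adown p.

Local Notation T := (chain_op B Aup Adown).
Local Notation M := (chain_M Aup).

(** [A_1 A_3 ... A_(2i-1)]. *)
Fixpoint chain_N (i : nat) : chain_space X Y i -> chain_space X Y 0 :=
  match i return chain_space X Y i -> chain_space X Y 0 with
  | O => fun x => x
  | S j => fun x => chain_N j (Adown j x)
  end.

Lemma chain_M_linear i : (i <= p)%nat -> is_linear (M i).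
Proof.
  induction i as [|i IH]; intros Hi.
  - exact (is_linear_id (V := chain_space X Y 0)).
  - exact (is_linear_comp _ _ (IH ltac:(lia)) (chain_Aup_bounded _ _ _ _ _ _ chain i Hi)).
Qed.

Lemma chain_N_linear i : (i <= p)%nat -> is_linear (chain_N i).
Proof.
  induction i as [|i IH]; intros Hi.
  - exact (is_linear_id (V := chain_space X Y 0)).
  - exact (is_linear_comp _ _ (chain_Adown_bounded _ _ _ _ _ _ chain i Hi) (IH ltac:(lia))).
Qed.

Lemma chain_op_linear i : (1 <= p)%nat -> (i <= p)%nat -> is_linear (T i).
Proof.
  intros Hp. destruct i as [|i]; intros Hi.
  - apply (is_linear_ext (fun x => Adown 0 (Aup 0 x))).
    + intros x. symmetry. apply (chain_factor _ _ _ _ _ _ chain 0%nat). lia.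
    + apply (is_linear_comp (Aup 0) (Adown 0)).
      * apply (chain_Aup_bounded _ _ _ _ _ _ chain). lia.
      * apply (chain_Adown_bounded _ _ _ _ _ _ chain). lia.
  - exact (is_linear_comp _ _ (chain_Adown_bounded _ _ _ _ _ _ chain i Hi)
      (chain_Aup_bounded _ _ _ _ _ _ chain i Hi)).
Qed.

(** Each factor [Aup i] carries [T i] to [T (S i)], as both composites equal
    [Aup i (Adown i (Aup i x))]; likewise for [Adown i] in the lemmas below. *)
Lemma chain_M_op i : (i <= p)%nat -> forall x, M i (B x) = T i (M i x).
Proof.
  induction i as [|i IH]; intros Hi x; [reflexivity|].
  change (Aup i (M i (B x)) = Aup i (Adown i (Aup i (M i x)))).
  rewrite IH by lia. f_equal. apply (chain_factor _ _ _ _ _ _ chain i Hi).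
Qed.

Lemma chain_N_op i : (i <= p)%nat -> forall z, B (chain_N i z) = chain_N i (T i z).
Proof.
  induction i as [|i IH]; intros Hi z; [reflexivity|].
  change (B (chain_N i (Adown i z)) = chain_N i (Adown i (Aup i (Adown i z)))).
  rewrite IH by lia. f_equal. apply (chain_factor _ _ _ _ _ _ chain i Hi).
Qed.

Lemma chain_N_M i : (i <= p)%nat -> forall x, chain_N i (M i x) = Nat.iter i B x.
Proof.
  induction i as [|i IH]; intros Hi x; [reflexivity|].
  change (chain_N i (Adown i (Aup i (M i x))) = B (Nat.iter i B x)).
  rewrite <- IH, chain_N_op by lia. f_equal. symmetry.
  apply (chain_factor _ _ _ _ _ _ chain i Hi).
Qed.

Lemma chain_M_N i : (i <= p)%nat -> forall z, M i (chain_N i z) = Nat.iter i (T i) z.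
Proof.
  induction i as [|i IH]; intros Hi z; [reflexivity|].
  change (Aup i (M i (chain_N i (Adown i z))) = Nat.iter (S i) (T (S i)) z).
  rewrite IH by lia. rewrite Nat.iter_succ_r.
  change (T (S i) z) with (Aup i (Adown i z)).
  apply (iter_semiconj (T i) (T (S i)) (Aup i)). intros x.
  change (Aup i (T i x) = Aup i (Adown i (Aup i x))). f_equal.
  apply (chain_factor _ _ _ _ _ _ chain i Hi).
Qed.

End Chain.

Lemma times_differentiable_half {s : scalar_field} {V : NormedModule (scalars s)}
    (n : nat) (f : R -> V) :
  times_differentiable n f -> @half_differentiable (realify V) n f.
Proof.
  revert f. induction n as [|n IH]; intros f; [exact (fun H => H)|].
  intros [g [Hg Hn]]. exists g. split; [|apply IH, Hn].
  intros t Ht. apply derivative_at_half, Hg, Ht.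
Qed.

Theorem theorem1
  (s : scalar_field) (X : CompleteNormedModule (scalars s))
  (Y : nat -> NormedModule (scalars s))
  (p : nat) (hp : (1 <= p)%nat)
  (B : X -> X) (hB : linear_map B)
  (Aup : forall i, chain_space X Y i -> chain_space X Y (S i))
  (Adown : forall i, chain_space X Y (S i) -> chain_space X Y i)
  (hchain : regular_skeleton_chain B Aup Adown p) :
  (forall f : R -> X, times_differentiable p f ->
    forall c0 : chain_space X Y p,
      exists x : R -> X,
        classical_solution B (chain_M Aup p) f c0 x /\
        (forall x' : R -> X, classical_solution B (chain_M Aup p) f c0 x' ->
           forall t, 0 <= t -> x' t = x t)) /\
  ((forall l : C, spectrum (chain_space X Y p) (chain_op B Aup Adown p) l -> Re l < 0) ->
    forall (c0 : chain_space X Y p) (x0 : R -> X),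
      homogeneous_solution B (chain_M Aup p) c0 x0 ->
      asymptotically_stable B (chain_M Aup p) c0 x0).
Proof.
  destruct hchain as [chain [D [HD [DT TD]]]].
  set (Xr := realify X). set (Zr := realify (chain_space X Y p)).
  set (M := chain_M Aup p). set (T := chain_op B Aup Adown p) in *.
  set (N := chain_N Adown p).
  assert (HT := chain_op_linear B Aup Adown p chain p hp (le_n p)).
  assert (HBr : @is_linear _ Xr Xr B).
  { apply realify_is_linear. apply (chain_op_linear B Aup Adown p chain 0 hp). lia. }
  assert (HMr : @is_linear _ Xr Zr M).
  { apply realify_is_linear. apply (chain_M_linear B Aup Adown p chain p (le_n p)). }
  assert (HNr : @is_linear _ Zr Xr N).
  { apply realify_is_linear. apply (chain_N_linear B Aup Adown p chain p (le_n p)). }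
  assert (HDr : @is_linear _ Zr Zr D) by (apply realify_is_linear, HD).
  assert (MB : forall x, M (B x) = T (M x)) by exact (chain_M_op B Aup Adown p chain p (le_n p)).
  assert (BN : forall z, B (N z) = N (T z)) by exact (chain_N_op B Aup Adown p chain p (le_n p)).
  assert (NM : forall x, N (M x) = Nat.iter p B x)
    by exact (chain_N_M B Aup Adown p chain p (le_n p)).
  assert (MN : forall z, M (N z) = Nat.iter p T z)
    by exact (chain_M_N B Aup Adown p chain p (le_n p)).
  assert (Hdiff : forall (f : R -> X) c c' (x x' : R -> X),
    classical_solution B M f c x -> classical_solution B M f c' x' ->
    @homogeneous Xr B (fun t => @minus Xr (x' t) (x t)) /\
    M (@minus Xr (x' 0) (x 0)) = @minus Zr c' c).
  { intros f c c' x x' [Hx Hx0] [Hx' Hx0']. split.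
    - intros t Ht. destruct (Hx t Ht) as [dx [Dx Bx]]. destruct (Hx' t Ht) as [dx' [Dx' Bx']].
      exists (@minus Xr dx' dx). split.
      + apply (@half_deriv_minus Xr); apply derivative_at_half; assumption.
      + rewrite (@linear_minus _ Xr Xr B _ _ HBr), Bx, Bx'.
        change (@minus Xr (@plus Xr (x' t) (f t)) (@plus Xr (x t) (f t)) = @minus Xr (x' t) (x t)).
        vec Xr.
    - rewrite (@linear_minus _ Xr Zr M _ _ HMr), Hx0, Hx0'. reflexivity. }
  split.
  - intros f Hf c0.
    destruct (@solution_exists Xr Zr B M N T D p HBr HMr HNr HDr DT TD MB BN NM MN f c0)
      as [x [Hx Hx0]].
    + exact (linear_ode_exists (realify_complete X)).
    + exact hp.
    + apply times_differentiable_half, Hf.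
    + assert (Sx : classical_solution B M f c0 x).
      { split; [|exact Hx0]. intros t Ht. destruct (Hx t Ht) as [dx [Dx Bx]].
        exists dx. split; [apply derivative_at_half, Dx | exact Bx]. }
      exists x. split; [exact Sx|]. intros x' Sx' t Ht.
      destruct (Hdiff f c0 c0 x x' Sx Sx') as [Hh H0].
      apply (@minus_eq_zero_eq _ Xr).
      apply (@homogeneous_zero Xr Zr B M N T D p HBr HMr HNr HDr DT MB NM _ Hh); [|exact Ht].
      rewrite H0. vec Zr.
  - intros Hspec c0 x0 Hx0.
    destruct (stable_spectrum_contracts T D HT HD DT TD Hspec) as [h [Ph Hh]].
    destruct (@exponential_decay Zr D h Ph Hh) as [c [a [Pc [Pa Hdecay]]]].
    destruct (@linear_norm _ Zr Xr _ (@lift_linear Xr Zr N D p HNr HDr)) as [k [Pk Hk]].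
    assert (Hhom : forall c x, homogeneous_solution B M c x ->
      classical_solution B M (fun _ => @zero X) c x).
    { intros c' x [Hx Hx']. split; [|exact Hx']. intros t Ht.
      destruct (Hx t Ht) as [dx [Dx Bx]]. exists dx. split; [exact Dx|].
      rewrite Bx. symmetry. apply (@plus_zero_r Xr). }
    assert (Hbound : forall c' x, homogeneous_solution B M c' x -> forall t, 0 <= t ->
      norm (minus (x t) (x0 t)) <= k * c * norm (minus c' c0) * exp (- (a * t))).
    { intros c' x Hx t Ht.
      destruct (Hdiff _ c0 c' x0 x (Hhom _ _ Hx0) (Hhom _ _ Hx)) as [Hw H0].
      set (w := fun t => @minus Xr (x t) (x0 t)) in *.
      change (@norm _ Xr (w t) <= k * c * @norm _ Zr (@minus Zr c' c0) * exp (- (a * t))).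
      rewrite (@homogeneous_eq_lift Xr Zr B M N T D p HBr HMr HNr HDr DT TD MB BN NM MN
        w Hw t Ht).
      eapply Rle_trans; [apply Hk|].
      assert (Hd := Hdecay (fun t => M (w t))
        (@homogeneous_M Xr Zr B M T D HMr DT MB w Hw) t Ht).
      assert (E0 : @norm _ Zr (M (w 0)) = @norm _ Zr (@minus Zr c' c0))
        by exact (f_equal (@norm _ Zr) H0).
      cbv beta in Hd. rewrite E0 in Hd.
      apply (Rmult_le_compat_l k) in Hd; [|lra]. eapply Rle_trans; [exact Hd|].
      right. ring. }
    assert (Pkc : 0 < k * c) by (apply Rmult_lt_0_compat; assumption).
    split.
    + intros eps He. exists (eps / (k * c)). split; [apply Rdiv_lt_0_compat; assumption|].
      intros c' x Hx Hc t Ht. eapply Rle_lt_trans; [apply (Hbound c' x Hx t Ht)|].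
      apply (Rmult_lt_compat_l (k * c)) in Hc; [|exact Pkc].
      replace (k * c * (eps / (k * c))) with eps in Hc by (field; lra).
      assert (E1 : exp (- (a * t)) <= 1).
      { rewrite <- exp_0. apply exp_le_exp.
        assert (0 <= a * t) by (apply Rmult_le_pos; lra). lra. }
      eapply Rle_lt_trans; [|exact Hc]. rewrite <- (Rmult_1_r (k * c * _)) at 2.
      apply Rmult_le_compat_l; [|exact E1].
      apply Rmult_le_pos; [lra | apply norm_ge_0].
    + exists 1. split; [lra|]. intros c' x Hx _.
      apply (is_lim_le_le_loc (fun _ => 0)
        (fun t => k * c * norm (minus c' c0) * exp (- (a * t)))).
      * exists 0. intros t Ht. split; [apply norm_ge_0|]. apply Hbound; [exact Hx | lra].
      * apply is_lim_const.
      * set (b := k * c * norm (minus c' c0)).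
        replace (Finite 0) with (Rbar_mult b 0) by (simpl; f_equal; ring).
        apply is_lim_scal_l.
        apply (is_lim_comp exp (fun t => - (a * t)) p_infty 0 m_infty).
        -- apply is_lim_exp_m.
        -- replace m_infty with (Rbar_mult (- a) p_infty).
           ++ apply (is_lim_ext (fun t => - a * t)); [intros t; ring|].
              apply is_lim_scal_l, is_lim_id.
           ++ simpl. destruct (Rle_dec 0 (- a)) as [H | H]; [exfalso; lra | reflexivity].
        -- exists 0. intros t _. discriminate.
Qed.
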